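(* In the QC setting described in the context, for every (deterministic) initial condition $\mathbf{x}(0)\in\mathbb{R}^N$, $$\mathbb{P}\Big[\lim_{i\to\infty}\rho\big(\mathbf{x}(i),\mathcal{C}\big)=0\Big]=1,$$ where $\rho(\mathbf{x},\mathcal{C})=\inf_{\mathbf{y}\in\mathcal{C}}\|\mathbf{x}-\mathbf{y}\|$ is the Euclidean distance to the consensus subspace $\mathcal{C}=\{a\mathbf{1}:a\in\mathbb{R}\}$.
   Context: QC setting. Let $N\ge 2$; all random objects live on one probability space. $\{L(i)\}_{i\ge0}$ is an i.i.d. sequence of random graph Laplacians $L(i)=D(i)-A(i)$, where $A(i)$ is the adjacency matrix (symmetric, $\{0,1\}$-valued, zero diagonal) of a random undirected simple graph on $\{1,\dots,N\}$, $D(i)=\mathrm{diag}(d_1(i),\dots,d_N(i))$ with $d_n(i)$ the degree of node $n$, and $\Omega_n(i)=\{l:A_{nl}(i)=1\}$. Link failures at a given time may be arbitrarily correlated across edges. Let $\overline{L}=\mathbb{E}[L(i)]$ with eigenvalues $0=\lambda_1(\overline{L})\le\lambda_2(\overline{L})\le\cdots\le\lambda_N(\overline{L})$; assume $\lambda_2(\overline{L})>0$. $\mathcal{M}$ denotes the set of realizable edges (those appearing in the random graph with positive probability). Quantizer: step $\Delta>0$, $q(y)=k\Delta$ if $(k-\tfrac12)\Delta\le y<(k+\tfrac12)\Delta$, $k\in\mathbb{Z}$. Dither: $\{\nu_{nl}(i)\}_{i\ge0,1\le n,l\le N}$ i.i.d. uniform on $[-\Delta/2,\Delta/2)$, independent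 of $\{L(i)\}$. Weights: deterministic $\alpha(i)>0$ with $\sum_i\alpha(i)=\infty$, $\sum_i\alpha^2(i)<\infty$. QC recursion: $x_n(i+1)=(1-\alpha(i)d_n(i))x_n(i)+\alpha(i)\sum_{l\in\Omega_n(i)}q(x_l(i)+\nu_{nl}(i))$, $1\le n\le N$. With $\varepsilon_{nl}(i)=q(x_l(i)+\nu_{nl}(i))-(x_l(i)+\nu_{nl}(i))$, $\Upsilon_n(i)=-\sum_{l\in\Omega_n(i)}\nu_{nl}(i)$, $\Psi_n(i)=-\sum_{l\in\Omega_n(i)}\varepsilon_{nl}(i)$, this reads $\mathbf{x}(i+1)=\mathbf{x}(i)-\alpha(i)[L(i)\mathbf{x}(i)+\Upsilon(i)+\Psi(i)]$. By the standard property of uniformly dithered quantization, conditionally on $\mathbf{x}(0),\{L(j),\Upsilon(j),\Psi(j)\}_{j<i}$ and $L(i)$, the $\varepsilon_{nl}(i)$ are i.i.d. uniform on $[-\Delta/2,\Delta/2)$ (as are the $\nu_{nl}(i)$). *)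

(* Defs.v *)
From HB Require Import structures.
From mathcomp Require Import all_boot all_order all_algebra.
From mathcomp Require Import all_classical all_reals all_analysis.
Set Implicit Arguments. Unset Strict Implicit. Unset Printing Implicit Defensive.
Import Order.TTheory GRing.Theory Num.Theory.
Import numFieldNormedType.Exports.
Local Open Scope classical_set_scope.
Local Open Scope ring_scope.

Section QC.
Context {R : realType} {N : nat}.

Definition graph := 'I_N -> 'I_N -> bool.

Definition simple_graph (g : graph) : Prop :=
  (forall n l, g n l = g l n) /\ (forall n, g n n = false).

Definition degree (g : graph) (n : 'I_N) : R := #|[set l | g n l]|%:R.

Definition laplacian (g : graph) : 'M[R]_N :=
  \matrix_(n, l) ((n == l)%:R * degree g n - (g n l)%:R).

(* Uniform quantizer with step D: q y = k D iff (k - 1/2) D <= y < (k + 1/2) D *)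
Definition quant (D y : R) : R := (Num.floor (y / D + 2^-1))%:~R * D.

Definition dist_consensus (x : 'I_N -> R) : R :=
  inf [set Num.sqrt (\sum_n (x n - a) ^+ 2) | a in [set: R]].

Fixpoint qc_state {T : Type} (x0 : 'I_N -> R) (alpha : nat -> R) (D : R)
    (A : nat -> T -> graph) (nu : nat -> 'I_N -> 'I_N -> T -> R)
    (i : nat) (t : T) : 'I_N -> R :=
  match i with
  | 0 => x0
  | i'.+1 => let x := qc_state x0 alpha D A nu i' t in
     fun n => (1 - alpha i' * degree (A i' t) n) * x n
              + alpha i' * \sum_(l | A i' t n l) quant D (x l + nu i' n l t)
  end.

Definition sorted_eigenvalues (M : 'M[R]_N) (lam : seq R) : Prop :=
  [/\ size lam = N, sorted <=%R lam &
      char_poly M = \prod_(x <- lam) ('X - x%:P)].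

End QC.

Section Indep.
Context {d : measure_display} {T : measurableType d} {R : realType}.

(* Mutual independence of a family of classes of events (e.g. the
   sigma-algebras generated by a family of random variables): the product
   rule holds for every finite subfamily. *)
Definition mutually_independent (P : probability T R) {I : eqType}
    (E : I -> set (set T)) : Prop :=
  forall (J : seq I) (F : I -> set T), uniq J ->
    (forall j, j \in J -> E j (F j)) ->
    P (\bigcap_(j in [set` J]) F j) = (\prod_(j <- J) P (F j))%E.

End Indep.

(* Main.v *)
Require Import Defs.
From HB Require Import structures.
From mathcomp Require Import all_boot all_order all_algebra.
From mathcomp Require Import all_classical all_reals all_analysis.
From mathcomp Require Import measurable_realfun ring lra.
Import Order.TTheory GRing.Theory Num.Theory.
Import numFieldNormedType.Exports.
Set Implicit Arguments. Unset Strict Implicit. Unset Printing Implicit Defensive.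
Local Open Scope classical_set_scope.
Local Open Scope ring_scope.

(* Let [V i] be the squared distance of the state to the consensus subspace.
   A simple eigenvalue 0 of the expected Laplacian makes the graph of the
   realizable edges connected, so its quadratic form dominates a multiple of
   [V]. The dithered quantizer is unbiased and its error is bounded, hence
   E[V (i+1) | past] <= (1 - c alpha_i) V i + C alpha_i^2 for large i. As the
   steps are not summable, E[V i] is small for arbitrarily large i; as their
   squares are summable, the maximal inequality for the nonnegative
   supermartingale V i + C sum_(j >= i) alpha_j^2 then bounds the probability
   that [V] ever becomes large again.
   Conditional expectations are avoided: the drift inequality is integrated
   over each event of the past, i.e. each event of a generated sigma-algebra. *)

(** The spectral gap is given only through the roots of a characteristic polynomial, so
    connectedness is obtained by counting the factors [X] of a determinant, without eigenvectors.
    The lower bound on the quadratic form then comes from a Poincaré inequality along paths, and its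
    constant need not be the second eigenvalue.

    Dither and quantization error are merged into the single error [q(x + v) - x]. For a given [x]
    the quantizer takes one of two neighbouring levels, decided by a threshold on the uniform
    dither; the chance of rounding up is the fractional part of [x / D], which makes the mean error
    zero.

    The average of the state is not preserved. The next state is therefore measured against the old
    average, which can only overestimate [V].

    The past comes in two layers: the graph at time [i] is averaged against the past, but the errors
    at time [i] are multiplied by adjacency entries, so they are averaged against the past enlarged
    by that graph. *)

(** * The expected Laplacian *)

(** Summing the rows of [X - M] over [S] gives [X] times the indicator of [S], and likewise for the
    complement. Installing both sums as rows changes the determinant by a unit only, and each of
    them yields a factor [X]. *)
Lemma char_poly_two_zero_blocks (F : fieldType) n (M : 'M[F]_n)
    (S : {set 'I_n}) (s s' : 'I_n) :
  s \in S -> s' \notin S ->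
  (forall l, \sum_(k in S) M k l = 0) ->
  (forall l, \sum_(k in ~: S) M k l = 0) ->
  ('X^2 %| char_poly M)%R.
Proof.
move=> sS s'S M1 M2.
have ss' : s' != s by apply: contra s'S => /eqP ->.
pose P : 'M[{poly F}]_n := \matrix_(i, k)
  (if i == s then (k \in S)%:R else if i == s' then (k \in ~: S)%:R
   else (i == k)%:R).
(* [P] replaces row [s] by the sum of the rows in [S] and row [s'] by the sum
   of the other rows; it is unipotent, hence has an inverse determinant. *)
pose E := P - 1%:M.
(* [E] lives on the rows [s] and [s'], while its columns [s] and [s'] vanish. Hence [1 - E] inverts
   [P = 1 + E]. *)
have EE : E *m E = 0.
  apply/matrixP => i k; rewrite !mxE; apply: big1 => j _; rewrite !mxE.
  have [->|js] := eqVneq j s; last have [->|js'] := eqVneq j s'.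
  - suff -> : (if i == s then (s \in S)%:R else
      if i == s' then (s \in ~: S)%:R else (i == s)%:R) - (i == s)%:R
      = 0 :> {poly F} by rewrite mul0r.
    have [_|] := eqVneq i s; first by rewrite sS subrr.
    by move=> _; rewrite inE sS; case: ifP; rewrite subrr.
  - suff -> : (if i == s then (s' \in S)%:R else
      if i == s' then (s' \in ~: S)%:R else (i == s')%:R) - (i == s')%:R
      = 0 :> {poly F} by rewrite mul0r.
    have [->|_] := eqVneq i s.
      by rewrite (negbTE s'S) eq_sym (negbTE ss') subrr.
    by rewrite inE s'S; have [_|_] := eqVneq i s'; rewrite subrr.
  - by rewrite subrr mulr0.
have detP : \det P * \det (1%:M - E) = 1.
  rewrite -det_mulmx -[P](subrK 1%:M) -/E mulmxBr mulmx1 mulmxDl EE add0r mul1mx.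
  by rewrite addrAC subrr add0r det1.
pose Q : 'M[{poly F}]_n := \matrix_(i, l)
  (if i == s then (l \in S)%:R else if i == s' then (l \in ~: S)%:R
   else char_poly_mx M i l).
pose r : 'rV[{poly F}]_n := \row_i (if (i == s) || (i == s') then 'X else 1).
have rows (U : {set 'I_n}) l : (forall l, \sum_(k in U) M k l = 0) ->
    \sum_k (k \in U)%:R * char_poly_mx M k l = 'X * (l \in U)%:R.
  move=> MU; under eq_bigr do rewrite mulr_natl mulrb.
  rewrite -big_mkcond /=.
  under eq_bigr do rewrite !mxE.
  rewrite sumrB.
  rewrite -(raddf_sum (@polyC F)) MU subr0.
  have [lU|lU] := boolP (l \in U).
    rewrite (bigD1 l)//= eqxx mulr1n mulr1 big1 ?addr0// => k /andP[_ /negbTE ->].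
    by rewrite mulr0n.
  rewrite big1 ?mulr0// => k kU; have [kl|] := eqVneq k l; rewrite ?mulr0n//.
  by rewrite kl (negbTE lU) in kU.
have PB : P *m char_poly_mx M = diag_mx r *m Q.
  apply/matrixP => i l; rewrite mul_diag_mx !mxE.
  have [->|is_] := eqVneq i s.
    under eq_bigr do rewrite [P _ _]mxE eqxx.
    by rewrite rows.
  have [->|is_'] := eqVneq i s'.
    under eq_bigr do rewrite [P _ _]mxE (negbTE ss') eqxx.
    by rewrite rows.
  under eq_bigr do rewrite [P _ _]mxE (negbTE is_) (negbTE is_').
  rewrite (bigD1 i)//= eqxx mul1r big1 ?addr0 ?mul1r ?mxE//.
  by move=> k /negbTE; rewrite eq_sym => ->; rewrite mul0r.
have -> : char_poly M = 'X^2 * (\det Q * \det (1%:M - E)).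
  rewrite -[LHS](mul1r (char_poly M)) -[X in X * char_poly M]detP mulrAC -det_mulmx.
  rewrite PB det_mulmx det_diag mulrA; congr (_ * _ * _).
  rewrite (bigD1 s)//= (bigD1 s')//= !mxE !eqxx orbT /= big1.
    by rewrite mulr1 -expr2.
  by move=> i /andP[/negbTE is_ /negbTE is_']; rewrite mxE is_ is_'.
exact: dvdp_mulr.
Qed.

(** In the sorted list all entries from the second on are positive, so at most one linear factor
    equals [X]. *)
Lemma sorted_eigenvalues_X2 (R : realType) n (M : 'M[R]_n) lam :
  sorted_eigenvalues M lam -> 0 < nth 0 lam 1 -> ~~ ('X^2 %| char_poly M).
Proof.
(* The default value 0 of [nth] excludes lists with fewer than two entries. *)
case=> _; case: lam => [|a [|b lam]] /=; rewrite ?ltxx//.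
move=> /andP[_ bl] -> b0; rewrite big_cons.
have nz : ~~ root (\prod_(x <- b :: lam) ('X - x%:P)) 0.
  rewrite root_prod_XsubC inE negb_or lt_eqF//=; apply/negP => l0.
  have := order_path_min le_trans bl => /allP /(_ _ l0).
  by rewrite leNgt b0.
apply/negP => dv.
have X0 : ('X : {poly R}) = 'X - 0%:P by rewrite subr0.
have ra : root (('X - a%:P) * \prod_(x <- b :: lam) ('X - x%:P)) 0.
  rewrite -dvdp_XsubCl -X0; apply: dvdp_trans dv; exact: dvdp_exp.
move: ra; rewrite rootM (negbTE nz) orbF root_XsubC => /eqP a0.
move: dv; rewrite -a0 -X0 exprS expr1 dvdp_mul2l ?polyX_eq0//.
by rewrite {1}X0 dvdp_XsubCl; apply/negP.
Qed.

(** * Disagreement and the coercivity of weighted Laplacians *)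

Section Disagreement.
Context {R : realType} {N : nat}.
Implicit Type x : 'I_N -> R.

Definition mean x : R := (\sum_n x n) / N%:R.

Definition disagreement x : R := \sum_n (x n - mean x) ^+ 2.

Lemma disagreement_ge0 x : 0 <= disagreement x.
Proof. by apply: sumr_ge0 => n _; exact: sqr_ge0. Qed.

(** Deviations from the mean sum to zero, so moving the centre to [a] only adds a square per
    node. *)
Lemma disagreement_le x a : (0 < N)%N ->
  disagreement x <= \sum_n (x n - a) ^+ 2.
Proof.
move=> N0; have N0' : N%:R != 0 :> R by rewrite pnatr_eq0 -lt0n.
have sm : \sum_n (x n - mean x) = 0.
  by rewrite sumrB sumr_const card_ord -mulr_natr /mean divfK// subrr.
have -> : \sum_n (x n - a) ^+ 2 =
    disagreement x + \sum_(n < N) (mean x - a) ^+ 2.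
  rewrite (eq_bigr (fun n => (x n - mean x) ^+ 2 + (mean x - a) ^+ 2 +
    2 * (mean x - a) * (x n - mean x))); last by move=> n _; ring.
  by rewrite big_split big_split /= -[X in _ + X]mulr_sumr sm mulr0 addr0.
by rewrite lerDl; apply: sumr_ge0 => n _; exact: sqr_ge0.
Qed.

Lemma dist_consensus_ge0 x : 0 <= dist_consensus x.
Proof.
apply: lb_le_inf; first by exists (Num.sqrt (\sum_n (x n - 0) ^+ 2)); exists 0.
by move=> _ [a _ <-]; exact: sqrtr_ge0.
Qed.

Lemma dist_consensus_le x : dist_consensus x <= Num.sqrt (disagreement x).
Proof.
apply: ge_inf; last by exists (mean x).
by exists 0 => _ [a _ <-]; exact: sqrtr_ge0.
Qed.

(** Exchanging the summation indices and averaging the two sums turns the factor [y n] into half of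
    [y n - y l]. *)
Lemma laplacian_form (w : 'I_N -> 'I_N -> R) (y : 'I_N -> R) :
  (forall n l, w n l = w l n) ->
  \sum_n \sum_l w n l * (y n * (y n - y l)) =
  2^-1 * \sum_n \sum_l w n l * (y n - y l) ^+ 2.
Proof.
move=> ws; set a := LHS.
have -> : \sum_n \sum_l w n l * (y n - y l) ^+ 2 = a + a.
  rewrite {2}/a [X in _ + X]exchange_big -big_split /=; apply: eq_bigr => n _.
  by rewrite -big_split /=; apply: eq_bigr => l _; rewrite (ws l n); ring.
lra.
Qed.

(** A disconnected support would give two blocks with zero column sums, hence a double root 0. In a
    connected one, the difference between a node and a fixed root is a sum of edge differences along
    a path, and each squared edge difference is at most the form divided by the weight of the
    edge. *)
Lemma weighted_laplacian_coercive (w : 'I_N -> 'I_N -> R) (lam : seq R) :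
  (2 <= N)%N ->
  (forall n l, w n l = w l n) -> (forall n l, 0 <= w n l) ->
  sorted_eigenvalues
    (\matrix_(n, l) ((n == l)%:R * (\sum_k w n k) - w n l)) lam ->
  0 < nth 0 lam 1 ->
  exists2 c : R, 0 < c & forall x,
    c * disagreement x <= \sum_n \sum_l w n l * (x n * (x n - x l)).
Proof.
move=> N2 ws w0 slam lam1.
pose e : rel 'I_N := fun n l => w n l != 0.
have es : connect_sym e.
  by apply: sym_connect_sym => n l; rewrite /e ws.
have conn s s' : connect e s s'.
  apply/negPn/negP => ss'.
  have Szero n l : connect e s n -> ~~ connect e s l -> w n l = 0.
    move=> sn; apply: contraNeq => wnl; apply: connect_trans sn _.
    exact: connect1.
  have := sorted_eigenvalues_X2 slam lam1; apply/negP/negPn.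
  (* For [l] in [U] the diagonal entry is the sum of row [l]; by symmetry, and as no weight leaves
     [U], it equals the sum of column [l] over [U]. *)
  have colsum (U : {set 'I_N}) l :
      (forall n l, n \in U -> l \notin U -> w n l = 0) ->
      \sum_(k in U) ((k == l)%:R * (\sum_j w k j) - w k l) = 0.
    move=> Uz; rewrite sumrB.
    have [lU|lU] := boolP (l \in U).
      rewrite (bigD1 l)//= eqxx mul1r [X in _ + X - _]big1 ?addr0; last first.
        by move=> k /andP[_ /negbTE ->]; rewrite mul0r.
      rewrite (bigID (mem U)) /= [X in _ + X - _]big1 ?addr0; last first.
        by move=> j jU; exact: Uz.
      by rewrite -sumrB big1// => k _; rewrite ws subrr.
    rewrite big1 ?sub0r; last first.
      move=> k kU; have [kl|] := eqVneq k l; last by rewrite mul0r.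
      by rewrite kl (negbTE lU) in kU.
    by rewrite big1 ?oppr0// => k kU; exact: Uz.
  apply: (@char_poly_two_zero_blocks _ _ _ [set n | connect e s n] s s').
  - by rewrite inE connect0.
  - by rewrite inE.
  - move=> l; under eq_bigr do rewrite mxE; apply: colsum => n k.
    by rewrite !inE; exact: Szero.
  - move=> l; under eq_bigr do rewrite mxE; apply: colsum => n k.
    rewrite !inE negbK => sn sk; rewrite ws; exact: Szero.
pose q x := \sum_n \sum_l w n l * (x n - x l) ^+ 2.
have q_ge n l x : w n l * (x n - x l) ^+ 2 <= q x.
  rewrite /q (bigD1 n)//= (bigD1 l)//= -addrA lerDl addr_ge0//.
    by apply: sumr_ge0 => *; rewrite mulr_ge0// sqr_ge0.
  by apply: sumr_ge0 => *; apply: sumr_ge0 => *; rewrite mulr_ge0// sqr_ge0.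
have q0 x : 0 <= q x.
  by apply: sumr_ge0 => n _; apply: sumr_ge0 => l _; rewrite mulr_ge0// sqr_ge0.
pose s : 'I_N := Ordinal (ltnW N2).
have bnd n : exists2 C : R, 0 <= C & forall x, (x n - x s) ^+ 2 <= C * q x.
  have /connectP[p] := conn s n.
  elim/last_ind: p n => [|p k IH] n /=.
    by move=> _ ->; exists 0 => // x; rewrite subrr expr0n mul0r.
  rewrite rcons_path last_rcons => /andP[/IH{}IH wk] ->.
  have [C C0 HC] := IH _ erefl; set m := last s p in wk HC.
  (* The square of a sum is at most twice the sum of the squares: [C] bounds the path up to [m], and
     [1 / w m k] the last edge. *)
  exists (2 * C + 2 / w m k) => [|x].
    by rewrite addr_ge0 ?mulr_ge0// ?invr_ge0.
  have wmk : 0 < w m k by rewrite lt_neqAle w0 eq_sym [_ != _]wk.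
  have h1 : (x k - x m) ^+ 2 <= (w m k)^-1 * q x.
    rewrite ler_pdivlMl//; apply: le_trans (q_ge m k x).
    by rewrite -sqrrN opprB.
  have := HC x; have := sqr_ge0 ((x k - x m) - (x m - x s)).
  rewrite mulrDl -!mulrA; set u := (w m k)^-1 * q x in h1 *.
  nra.
have [C C0 HC] : exists2 C : R, 0 < C & forall x, disagreement x <= C * q x.
  have /choice [C HC] : forall n, exists C : R,
      0 <= C /\ forall x, (x n - x s) ^+ 2 <= C * q x.
    by move=> n; have [C] := bnd n; exists C.
  exists (1 + \sum_n C n) => [|x].
    by rewrite ltr_pwDl// sumr_ge0// => n _; case: (HC n).
  apply: (le_trans (disagreement_le _ (x s) (ltnW N2))).
  rewrite mulrDl mul1r mulr_suml; apply: ler_wpDl; first exact: q0.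
  by apply: ler_sum => n _; case: (HC n).
(* The factor 1/2 is the one of [laplacian_form]. *)
exists (C^-1 / 2) => [|x]; first by rewrite divr_gt0// invr_gt0.
rewrite laplacian_form// -/(q x) mulrAC mulrC ler_wpM2l//.
by rewrite ler_pdivrMl.
Qed.

End Disagreement.

(** * Independence *)

(** Finite intersections of events with indices in [J] form a pi-system on which the product rule is
    the hypothesis. The finite measures [A |-> P (A & B)] and [A |-> P B * P A] agree there, hence
    on the generated sigma-algebra. *)
Lemma mutually_independent_sigma (d : measure_display) (T : measurableType d)
    (R : realType) (P : probability T R) (I : eqType) (E : I -> set (set T))
    (J : set I) (k : I) :
  (forall i, E i `<=` measurable) ->
  (forall i, setI_closed (E i)) -> (forall i, E i setT) ->
  mutually_independent P E -> ~ J k ->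
  forall F B, <<s \bigcup_(j in J) E j >> F -> E k B ->
  P (F `&` B) = (P F * P B)%E.
Proof.
move=> mE EI ET indE Jk F B sF EB.
pose C : set (set T) := [set A | exists (s : seq I) (G : I -> set T),
  [/\ uniq s, (forall j, j \in s -> J j), (forall j, j \in s -> E j (G j)) &
      A = \bigcap_(j in [set` s]) G j]].
have mC : C `<=` measurable.
  move=> _ [s [G [us sJ sE ->]]]; apply: fin_bigcap_measurable => //.
  by move=> j js; apply: mE; exact: sE.
have CI : setI_closed C.
  move=> _ _ [s [G [us sJ sE ->]]] [s' [G' [us' sJ' sE' ->]]].
  (* Indices absent from one of the two lists are filled with the full event. *)
  pose H j := (if j \in s then G j else setT) `&`
              (if j \in s' then G' j else setT).
  exists (undup (s ++ s')), H; split.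
  - exact: undup_uniq.
  - by move=> j; rewrite mem_undup mem_cat => /orP[/sJ|/sJ'].
  - move=> j _; apply: EI; case: ifPn => // js; [exact: sE|exact: sE'].
  - apply/seteqP; split => t.
    + move=> [h h'] j _; split; case: ifPn => // js; [exact: h|exact: h'].
    + move=> h; split => j /= js; have : j \in undup (s ++ s').
      * by rewrite mem_undup mem_cat js.
      * by move=> /h[]; rewrite js.
      * by rewrite mem_undup mem_cat js orbT.
      * by move=> /h[_]; rewrite js.
have mB : measurable B by exact: mE EB.
have PB0 : 0 <= fine (P B) by exact: fine_ge0.
have PBE : P B = (fine (P B))%:E by rewrite fineK// fin_num_measure.
have scaleE A : mscale (NngNum PB0) P A = (P B * P A)%E.
  by transitivity ((fine (P B))%:E * P A)%E => //; rewrite -PBE.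
have sC : <<s C >> F.
  apply: (smallest_sub (smallest_sigma_algebra _ _) _ sF) => A [j Jj EA].
  apply: sub_gen_smallest; exists [:: j], (fun=> A); split => //.
  - by move=> i; rewrite inE => /eqP ->.
  - by move=> i; rewrite inE => /eqP ->.
  - apply/seteqP; split => [t At i _ //|t]; apply => /=; exact: mem_head.
have := @g_sigma_algebra_measure_unique _ R T C mC (fun=> setT) _ _
  (mrestr P mB) (mscale (NngNum PB0) P) CI _ _ _ sC.
rewrite /= scaleE muleC; apply.
- move=> _; exists [::], (fun=> setT); split => //.
  by rewrite bigcapT.
- by rewrite bigcup_const//; exists 0%N.
- move=> _ [s [G [us sJ sE ->]]].
  rewrite [LHS]/mrestr /= scaleE.
  have ks : k \notin s by apply/negP => /sJ.
  (* The index [k] joins the list [s] with the event [B], so that joint independence applies to both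
     together. *)
  pose H j := if j == k then B else G j.
  have HG j : j \in s -> H j = G j.
    by move=> js; rewrite /H; case: eqP => // jk; rewrite jk (negbTE ks) in js.
  have -> : \bigcap_(j in [set` s]) G j `&` B = \bigcap_(j in [set` k :: s]) H j.
    apply/seteqP; split => t.
      move=> [h Bt] j /=; rewrite inE => /predU1P[->|js].
        by rewrite /H eqxx.
      by rewrite HG//; exact: h.
    move=> h; split => [j /= js|].
      by have := h j; rewrite HG//=; apply; rewrite inE js orbT.
    by have := h k; rewrite /H eqxx; apply => /=; rewrite mem_head.
  rewrite indE/= ?ks//; last first.
    move=> j; rewrite inE => /predU1P[->|js]; first by rewrite /H eqxx.
    by rewrite HG//; exact: sE.
  rewrite big_cons {1}/H eqxx indE//; congr (_ * _)%E.
  rewrite big_seq [RHS]big_seq; apply: eq_bigr => j js.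
  by rewrite HG.
- move=> _; apply: (le_lt_trans (measureIl _ _ _)) => //.
  by apply: (le_lt_trans (probability_le1 _ _)) => //; exact: ltry.
Qed.

(** * Expectation of bounded random variables *)

(** The bound holds at every point, so it refers to no measure: it gives integrability under any
    probability and passes to compositions and to smaller sigma-algebras. *)
Definition bounded_mfun (d : measure_display) (T : measurableType d)
    (R : realType) (f : T -> R) : Prop :=
  measurable_fun setT f /\ exists M, forall t, `|f t| <= M.

Section BoundedExpectation.
Context (d : measure_display) (T : measurableType d) (R : realType).
Variable P : probability T R.
Implicit Types f g : T -> R.

Lemma bounded_mfun_integrable f : bounded_mfun f -> P.-integrable setT (EFin \o f).
Proof.
move=> [mf [M fM]]; apply: measurable_bounded_integrable => //.
  by rewrite -ge0_fin_numE// fin_num_measure.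
exists M; split; first exact: num_real.
by move=> y My t _; apply: le_trans (fM t) (ltW My).
Qed.

Lemma bounded_mfun_cst (a : R) : bounded_mfun (fun _ : T => a).
Proof. by split; [exact: measurable_cst|exists `|a|]. Qed.

Lemma bounded_mfunD f g : bounded_mfun f -> bounded_mfun g ->
  bounded_mfun (fun t => f t + g t).
Proof.
move=> [mf [M fM]] [mg [M' gM]]; split; first exact: measurable_funD.
by exists (M + M') => t; apply: le_trans (ler_normD _ _) _; exact: lerD.
Qed.

Lemma bounded_mfunM f g : bounded_mfun f -> bounded_mfun g ->
  bounded_mfun (fun t => f t * g t).
Proof.
move=> [mf [M fM]] [mg [M' gM]]; split; first exact: measurable_funM.
by exists (M * M') => t; rewrite normrM ler_pM.
Qed.

Lemma bounded_mfunB f g : bounded_mfun f -> bounded_mfun g ->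
  bounded_mfun (fun t => f t - g t).
Proof.
move=> [mf [M fM]] [mg [M' gM]]; split; first exact: measurable_funB.
exists (M + M') => t; apply: le_trans (ler_normB _ _) _; exact: lerD.
Qed.

Lemma bounded_mfun_sum (I : Type) (s : seq I) (F : I -> T -> R) :
  (forall i, bounded_mfun (F i)) -> bounded_mfun (fun t => \sum_(i <- s) F i t).
Proof.
move=> bF; elim: s => [|i s IH].
  under [X in bounded_mfun X]eq_fun do rewrite big_nil.
  exact: bounded_mfun_cst.
under [X in bounded_mfun X]eq_fun do rewrite big_cons.
exact: bounded_mfunD.
Qed.

Lemma bounded_mfun_indic (A : set T) : measurable A -> bounded_mfun (\1_A : T -> R).
Proof.
move=> mA; split; first exact: measurable_indic.
by exists 1 => t; rewrite indicE; case: (_ \in _); rewrite ?normr1// normr0.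
Qed.

Lemma bounded_RintegralD f g : bounded_mfun f -> bounded_mfun g ->
  \int[P]_t (f t + g t) = \int[P]_t f t + \int[P]_t g t.
Proof.
by move=> bf bg; apply: RintegralD => //; exact: bounded_mfun_integrable.
Qed.

Lemma bounded_RintegralB f g : bounded_mfun f -> bounded_mfun g ->
  \int[P]_t (f t - g t) = \int[P]_t f t - \int[P]_t g t.
Proof.
by move=> bf bg; apply: RintegralB => //; exact: bounded_mfun_integrable.
Qed.

Lemma bounded_RintegralZ (a : R) f : bounded_mfun f ->
  \int[P]_t (a * f t) = a * \int[P]_t f t.
Proof. by move=> bf; apply: RintegralZl => //; exact: bounded_mfun_integrable. Qed.

Lemma bounded_Rintegral_le f g : bounded_mfun f -> bounded_mfun g ->
  (forall t, f t <= g t) -> \int[P]_t f t <= \int[P]_t g t.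
Proof.
by move=> bf bg fg; apply: le_Rintegral => //; exact: bounded_mfun_integrable.
Qed.

Lemma bounded_Rintegral_sum (I : Type) (s : seq I) (F : I -> T -> R) :
  (forall i, bounded_mfun (F i)) ->
  \int[P]_t (\sum_(i <- s) F i t) = \sum_(i <- s) \int[P]_t F i t.
Proof.
move=> bF; elim: s => [|i s IH].
  under eq_Rintegral do rewrite big_nil.
  by rewrite Rintegral_cst// mul0r big_nil.
under eq_Rintegral do rewrite big_cons.
by rewrite bounded_RintegralD ?big_cons ?IH//; exact: bounded_mfun_sum.
Qed.

Lemma Rintegral_indic (A : set T) : measurable A ->
  \int[P]_t (\1_A t : R) = fine (P A).
Proof. by move=> mA; rewrite /Rintegral integral_indic// setIT. Qed.

End BoundedExpectation.

(* Conditioning on [X]: the threshold [th X] is frozen while [Y] is averaged. *)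
Lemma indep_threshold (d d' : measure_display) (T : measurableType d)
    (S : measurableType d') (R : realType) (P : probability T R)
    (X : T -> S) (Y : T -> R) (h th : S -> R) :
  measurable_fun setT X -> measurable_fun setT Y ->
  (forall A B, measurable A -> measurable B ->
    P (X @^-1` A `&` Y @^-1` B) = (P (X @^-1` A) * P (Y @^-1` B))%E) ->
  bounded_mfun h -> measurable_fun setT th ->
  \int[P]_t (h (X t) * (th (X t) <= Y t)%R%:R) =
  \int[P]_t (h (X t) * fine (P [set u | th (X t) <= Y u])).
Proof.
move=> mX mY indXY [mh [M hM]] mth.
pose X' : {mfun T >-> S} := HB.pack X (isMeasurableFun.Build _ _ _ _ _ mX).
pose Y' : {mfun T >-> R} := HB.pack Y (isMeasurableFun.Build _ _ _ _ _ mY).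
have mXY : measurable_fun setT (fun t => (X t, Y t)).
  exact: measurable_fun_pair.
pose XY' : {mfun T >-> (S * R)%type} :=
  HB.pack (fun t => (X t, Y t)) (isMeasurableFun.Build _ _ _ _ _ mXY).
pose f (z : S * R) : R := h z.1 * (th z.1 <= z.2)%R%:R.
have mind : measurable_fun setT (fun z : S * R => (th z.1 <= z.2)%R%:R : R).
  have -> : (fun z : S * R => (th z.1 <= z.2)%R%:R : R) =
      \1_[set z : S * R | th z.1 <= z.2].
    by apply/funext => z; rewrite indicE mem_setE.
  apply: measurable_indic; rewrite -[X in measurable X]setTI.
  apply: measurable_fun_ler => //; exact: measurableT_comp.
have bf : bounded_mfun f.
  split; first by apply: measurable_funM => //; exact: measurableT_comp.
  exists M => z; rewrite /f normrM normr_nat; case: (th _ <= _).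
    by rewrite mulr1.
  by rewrite mulr0; apply: le_trans (hM z.1).
have intf (Q : probability (S * R)%type R) : Q.-integrable setT (EFin \o f).
  exact: bounded_mfun_integrable.
have mEf : measurable_fun setT (EFin \o f).
  by apply/measurable_EFinP; case: bf.
congr fine.
transitivity (\int[distribution P XY']_z (EFin \o f) z)%E.
  rewrite integral_distribution//.
  apply: bounded_mfun_integrable; case: bf => mf [M' fM'].
  by split; [exact: (measurableT_comp mf mXY)|exists M' => t; exact: fM'].
(* The joint law agrees with the product of the marginals on rectangles, hence everywhere; Fubini
   then integrates the indicator over [Y] for a fixed value of [X]. *)
transitivity (\int[distribution P X' \x distribution P Y']_z (EFin \o f) z)%E.
  apply: eq_measure_integral => /= A mA _.
  by apply/esym/product_measure_unique => // B C mB mC; exact: indXY.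
have intp : (distribution P X' \x distribution P Y')%E.-integrable setT (EFin \o f).
  apply: measurable_bounded_integrable => //.
  - apply: (@le_lt_trans _ _ (distribution P X' setT * distribution P Y' setT)%E).
      rewrite le_eqVlt; apply/orP; left; apply/eqP; rewrite -setXTT.
      exact: product_measure1E.
    by rewrite -ge0_fin_numE ?mule_ge0// fin_numM//; exact: fin_num_measure.
  - by case: bf.
  - case: bf => _ [M' fM']; exists M'; split; first exact: num_real.
    by move=> y My z _; exact: le_trans (fM' z) (ltW My).
rewrite -integral12_prod_meas1//.
have mge a : measurable [set u | a <= Y u].
  rewrite -[X in measurable X]setTI.
  by apply: measurable_fun_ler => //; exact: measurable_cst.
pose p (a : R) := fine (P [set u | a <= Y u]).
have inner x : (\int[distribution P Y']_y (EFin \o f) (x, y) = (h x * p (th x))%:E)%E.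
  rewrite /f /=.
  under eq_integral do rewrite EFinM.
  rewrite integralZl//; last first.
    apply: bounded_mfun_integrable; split; last first.
      by exists 1 => y; rewrite normr_nat; case: (th _ <= _).
    exact: (measurableT_comp mind (measurable_fun_pair (measurable_cst _) (@measurable_id _ _ _))).
  rewrite EFinM; congr (_ * _)%E.
  have -> : (fun y : R => ((th x <= y)%R%:R : R)%:E) = EFin \o \1_[set y : R | th x <= y].
    by apply/funext => y; rewrite /= indicE mem_setE.
  have mth' : measurable [set y : R | th x <= y].
    rewrite -[X in measurable X]setTI.
    by apply: measurable_fun_ler => //; exact: measurable_cst.
  rewrite integral_indic// setIT /p fineK//; apply: fin_num_measure.
  by have := mY measurableT _ mth'; rewrite setTI.
rewrite (eq_integral (fun x => (h x * p (th x))%:E)); last first.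
  by move=> x _; exact: inner.
have mhp : measurable_fun setT (fun x => (h x * p (th x))%:E).
  have := measurable_fubini_F intp.
  rewrite /fubini_F (_ : (fun _ => _) = fun x => (h x * p (th x))%:E)//.
  by apply/funext => x; exact: inner.
rewrite integral_distribution//.
apply: bounded_mfun_integrable; split.
  have mhp' : measurable_fun setT (fun x => h x * p (th x)).
    by apply/measurable_EFinP.
  exact: (measurableT_comp mhp' mX).
exists M => t; rewrite normrM -[leRHS]mulr1 ler_pM// ger0_norm ?fine_ge0//.
by rewrite -lee_fin fineK ?fin_num_measure ?probability_le1.
Qed.

(** * Almost supermartingales *)

Section DeterministicRecursion.
Context (R : realType) (alpha : nat -> R).
Hypothesis alpha_gt0 : forall n, 0 < alpha n.
Hypothesis alpha_sq : cvgn (series (fun n => alpha n ^+ 2)).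

Lemma series_sq_le n :
  series (fun n => alpha n ^+ 2) n <= limn (series (fun n => alpha n ^+ 2)).
Proof.
apply: nondecreasing_cvgn_le => //.
by apply/nondecreasing_seqP => k; rewrite seriesSr lerDl sqr_ge0.
Qed.

(** If [a] stayed above [delta], every late step would lose at least [c * delta * alpha n] up to a
    summable term; telescoping would bound the partial sums of [alpha]. *)
Lemma drift_frequently_small (a : nat -> R) (c C : R) (n0 : nat) :
  series alpha @ \oo --> +oo -> (forall n, 0 <= a n) -> 0 < c -> 0 <= C ->
  (forall n, (n0 <= n)%N ->
     a n.+1 <= (1 - c * alpha n) * a n + C * alpha n ^+ 2) ->
  forall (delta : R) (m : nat), 0 < delta -> exists2 n, (m <= n)%N & a n < delta.
Proof.
move=> alphaoo a0 c0 C0 rec delta m d0; apply: contrapT => H.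
have ad n : (m <= n)%N -> delta <= a n.
  by move=> mn; rewrite leNgt; apply/negP => an; apply: H; exists n.
pose k := maxn m n0; set s2 := series (fun n => alpha n ^+ 2).
have s2S n : s2 n.+1 = s2 n + alpha n ^+ 2 by rewrite /s2 seriesSr.
have tele j : c * delta * (series alpha (j + k)%N - series alpha k) <=
    a k - a (j + k)%N + C * (s2 (j + k)%N - s2 k).
  elim: j => [|j IH]; first by rewrite add0n !subrr !mulr0 addr0.
  rewrite addSn s2S seriesSr.
  have kj : (k <= j + k)%N by rewrite leq_addl.
  have := rec _ (leq_trans (leq_maxr _ _) kj).
  have := ad _ (leq_trans (leq_maxl _ _) kj).
  have := alpha_gt0 (j + k)%N; set x := alpha _ => x0 dy rj.
  have : c * delta * x <= c * x * a (j + k)%N by rewrite mulrAC ler_wpM2l// mulr_ge0// ltW.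
  lra.
have /cvgryPge/(_ (series alpha k + (a k + C * limn s2) / (c * delta) + 1)) := alphaoo.
move=> [n _ Hn]; have /= := Hn (n + k)%N (leq_addr _ _).
apply/negP; rewrite -ltNge.
have : (series alpha (n + k)%N - series alpha k) <= (a k + C * limn s2) / (c * delta).
  rewrite ler_pdivlMr ?mulr_gt0// mulrC; apply: le_trans (tele n) _.
  have /(ler_wpM2l C0) := series_sq_le (n + k)%N.
  have : 0 <= C * s2 k.
    by rewrite mulr_ge0// sumr_ge0// => i _; exact: sqr_ge0.
  have := a0 (n + k)%N; rewrite -/s2; lra.
lra.
Qed.

End DeterministicRecursion.

(** * Maximal inequality and almost sure convergence *)

Section AlmostSupermartingale.
Context (d : measure_display) (T : measurableType d) (R : realType).
Variable P : probability T R.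
Variables (V : nat -> T -> R) (G : nat -> set (set T)).
Variables (alpha : nat -> R) (c C : R) (n0 : nat).
Hypothesis Gm : forall n, G n `<=` measurable.
Hypothesis GS : forall n, G n `<=` G n.+1.
Hypothesis V_ge0 : forall n t, 0 <= V n t.
Hypothesis V_bounded : forall n, bounded_mfun (V n).
Hypothesis V_adapted : forall n e, <<s G n >> [set t | V n t < e].
Hypothesis alpha_gt0 : forall n, 0 < alpha n.
Hypothesis alpha_oo : series alpha @ \oo --> +oo.
Hypothesis alpha_sq : cvgn (series (fun n => alpha n ^+ 2)).
Hypothesis c_gt0 : 0 < c.
Hypothesis C_ge0 : 0 <= C.
Hypothesis drift : forall n H, (n0 <= n)%N -> <<s G n >> H ->
  \int[P]_t (\1_H t * V n.+1 t) <=
  (1 - c * alpha n) * \int[P]_t (\1_H t * V n t) + C * alpha n ^+ 2.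

Let s2 := series (fun n => alpha n ^+ 2).

Let sigma_measurable n : <<s G n >> `<=` measurable.
Proof. by apply: smallest_sub (Gm (n:=n)); exact: sigma_algebra_measurable. Qed.

Let s2S n : s2 n.+1 = s2 n + alpha n ^+ 2.
Proof. by rewrite /s2 seriesSr. Qed.

Let below (e : R) n m : set T := [set t | forall j, (j < m)%N -> V (j + n)%N t < e].

Let belowS e n m : below e n m.+1 = below e n m `&` [set t | V (m + n)%N t < e].
Proof.
apply/seteqP; split => t /=.
  by move=> h; split => [j jm|]; apply: h => //; exact: leqW.
by move=> [h hm] j; rewrite ltnS leq_eqVlt => /predU1P[->//|]; exact: h.
Qed.

(** The index shift matters: [below e n m.+1] looks at times up to [m + n] only, so [drift] may be
    integrated over it for the step from [m + n] to the next time. These events play the role of a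
    stopping time. *)
Let sigma_below e n m : <<s G (m + n)%N >> (below e n m.+1).
Proof.
elim: m => [|m IH].
  rewrite belowS (_ : below e n 0 = setT) ?setTI; first exact: V_adapted.
  by apply/seteqP; split.
rewrite belowS; apply: (@measurableI _ (g_sigma_algebraType (G (m.+1 + n)%N))).
  exact: (@sub_sigma_algebra2 _ setT _ _ (@GS _) _ IH).
exact: V_adapted.
Qed.

Let measurable_below e n m : measurable (below e n m).
Proof.
case: m => [|m]; last exact: (@sigma_measurable (m + n)%N _ (@sigma_below e n m)).
by rewrite (_ : below e n 0 = setT)//; apply/seteqP; split.
Qed.

(** Optional stopping by hand: a path that has reached the level counts as [e] forever, the other
    paths follow the drift, and the right-hand side accumulates the additive terms
    [C * alpha ^+ 2]. *)
Let maximal_aux e n m : 0 < e -> (n0 <= n)%N ->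
  e * fine (P (~` below e n m)) + \int[P]_t (\1_(below e n m) t * V (m + n)%N t)
  <= \int[P]_t V n t + C * (s2 (m + n)%N - s2 n).
Proof.
move=> e0 nn0; elim: m => [|m IH].
  rewrite (_ : below e n 0 = setT); last by apply/seteqP; split.
  rewrite setCT measure0 mulr0 add0r add0n subrr mulr0 addr0.
  by under eq_Rintegral do rewrite indicE in_setT mul1r.
set H := below e n m in IH *; set H' := below e n m.+1.
have mH : measurable H by exact: measurable_below.
have mH' : measurable H' by exact: measurable_below.
have bH := bounded_mfun_indic R mH; have bH' := bounded_mfun_indic R mH'.
have bHc := bounded_mfun_indic R (measurableC mH).
have bHc' := bounded_mfun_indic R (measurableC mH').
have bV := V_bounded (m + n)%N.
have nm : (n0 <= m + n)%N by rewrite (leq_trans nn0)// leq_addl.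
(* A path in [H] but not in [H'] has [V >= e] at time [m + n], so freezing it at [e] lowers the
   integral. *)
have HH' : \int[P]_t (e * \1_(~` H') t + \1_H' t * V (m + n)%N t) <=
    \int[P]_t (e * \1_(~` H) t + \1_H t * V (m + n)%N t).
  apply: bounded_Rintegral_le.
  - by apply: bounded_mfunD; apply: bounded_mfunM => //; exact: bounded_mfun_cst.
  - by apply: bounded_mfunD; apply: bounded_mfunM => //; exact: bounded_mfun_cst.
  move=> t; rewrite !indicE !in_setC /H' belowS in_setI -/H.
  case: (t \in H) => /=; last by rewrite !mul0r.
  case: (boolP (t \in _)) => /=; first by rewrite lexx.
  rewrite notin_setE /= => /negP; rewrite -leNgt mulr1 mul0r mulr0 addr0 add0r mul1r.
  by [].
move: HH'; rewrite !bounded_RintegralD ?bounded_RintegralZ//;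
  try by apply: bounded_mfunM => //; exact: bounded_mfun_cst.
rewrite !Rintegral_indic//; try exact: measurableC.
move=> HH'.
have := drift nm (@sigma_below e n m); rewrite -/H' => dr.
have iV0 : 0 <= \int[P]_t (\1_H' t * V (m + n)%N t).
  by apply: Rintegral_ge0 => t _; rewrite mulr_ge0// indicE.
(* The contraction term is dropped by its sign. *)
have := mulr_ge0 (mulr_ge0 (ltW c_gt0) (ltW (alpha_gt0 (m + n)))) iV0.
by rewrite addSn s2S; lra.
Qed.

Let exceed (e : R) n : set T := [set t | exists2 j, (n <= j)%N & e <= V j t].

Let exceedE e n : exceed e n = \bigcup_m ~` below e n m.
Proof.
apply/seteqP; split => t /=.
  move=> [j nj ej]; exists (j - n).+1 => // h.
  by have := h (j - n)%N (ltnSn _); rewrite subnK// ltNge ej.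
move=> [m _ /existsNP[j /not_implyP[jm /negP]]]; rewrite -leNgt => h.
by exists (j + n)%N => //; exact: leq_addl.
Qed.

Let measurable_exceed e n : measurable (exceed e n).
Proof.
by rewrite exceedE; apply: bigcup_measurable => m _; apply: measurableC.
Qed.

(** The bound for a finite horizon is uniform in [m], and [exceed] is the increasing union of the
    complements of [below]. *)
Let maximal e n : 0 < e -> (n0 <= n)%N ->
  e * fine (P (exceed e n)) <= \int[P]_t V n t + C * (limn s2 - s2 n).
Proof.
move=> e0 nn0; rewrite -ler_pdivlMl//.
set B := _^-1 * _.
rewrite -lee_fin fineK ?fin_num_measure// exceedE.
have nd : nondecreasing_seq (fun m => ~` below e n m).
  move=> m m' mm'; apply/subsetPset; apply: subsetC => t h j jm; apply: h.
  exact: leq_trans jm mm'.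
have mb m : measurable (~` below e n m) by exact: measurableC.
have cv := nondecreasing_cvg_mu (mu := P) mb (bigcupT_measurable _ mb) nd.
rewrite -(cvg_lim _ cv)//; apply: lime_le; first by apply/cvg_ex; eexists; exact: cv.
apply: nearW => m /=.
rewrite -[leLHS]fineK ?fin_num_measure// lee_fin ler_pdivlMl//.
have := maximal_aux m e0 nn0.
have : 0 <= \int[P]_t (\1_(below e n m) t * V (m + n)%N t).
  by apply: Rintegral_ge0 => t _; rewrite mulr_ge0// indicE.
have := ler_wpM2l C_ge0 (series_sq_le alpha_sq (m + n)%N); rewrite -/s2.
lra.
Qed.

Theorem almost_supermartingale_cvg0 : {ae P, forall t, V ^~ t @ \oo --> 0}.
Proof.
have EV0 n : 0 <= \int[P]_t V n t by apply: Rintegral_ge0.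
have EVrec n : (n0 <= n)%N ->
    \int[P]_t V n.+1 t <= (1 - c * alpha n) * \int[P]_t V n t + C * alpha n ^+ 2.
  move=> nn0; have := drift nn0 (@measurableT _ (g_sigma_algebraType (G n))).
  under eq_Rintegral do rewrite indicE in_setT mul1r.
  under [X in _ * X]eq_Rintegral do rewrite indicE in_setT mul1r.
  by [].
(* The event that [V] is at least [1 / (k + 1)] at arbitrarily late times; off the union of these
   events [V] tends to 0. *)
pose B k := \bigcap_n exceed k.+1%:R^-1 n.
have mB k : measurable (B k) by exact: bigcapT_measurable.
have PB k : P (B k) = 0%E.
  set e : R := k.+1%:R^-1; have e0 : 0 < e by rewrite invr_gt0 ltr0n.
  suff : fine (P (B k)) <= 0.
    move=> h; apply/eqP; rewrite eq_le measure_ge0 andbT.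
    by rewrite -[leLHS]fineK ?fin_num_measure.
  apply/ler_addgt0Pr => eta eta0; rewrite add0r.
  (* Half of the allowance [e * eta] goes to the tail of the squares, half to the expectation of
     [V n]. The divisor [C + 1] covers the case [C = 0]. *)
  have [m _ Hm] : \forall n \near \oo, C * (limn s2 - s2 n) < e * eta / 2.
    have C1 : 0 < C + 1 by rewrite ltr_wpDl.
    have /cvgrPdist_lt/(_ (e * eta / 2 / (C + 1))) := alpha_sq.
    rewrite !divr_gt0 ?mulr_gt0// => /(_ isT); apply: filterS => n.
    rewrite ltr_pdivlMr// => h.
    have : 0 <= limn s2 - s2 n by rewrite subr_ge0; exact: series_sq_le.
    move=> h0; rewrite ger0_norm// in h.
    by apply: le_lt_trans h; rewrite mulrC ler_wpM2l// lerDl.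
  have [n mn an] := drift_frequently_small alpha_gt0 alpha_sq alpha_oo EV0 c_gt0
    C_ge0 EVrec (maxn m n0) (divr_gt0 (mulr_gt0 e0 eta0) (ltr0Sn R 1)).
  move: mn; rewrite geq_max => /andP[mn n0n].
  apply: (@le_trans _ _ (fine (P (exceed e n)))).
    apply: fine_le; rewrite ?fin_num_measure//.
    by apply: le_measure; rewrite ?inE//; apply: bigcap_inf.
  rewrite -(ler_pM2l e0); apply: le_trans (maximal e0 n0n) _.
  have := Hm n mn; move=> /= ?; lra.
have : P.-negligible (\bigcup_k B k).
  by apply: negligible_bigcup => k; apply/negligibleP; [exact: mB|exact: PB].
apply: negligibleS => t /= ncv; apply: contrapT => nB; apply: ncv.
apply/cvgrPdist_lt => e e0.
have [k] : exists k : nat, k.+1%:R^-1 < e.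
  have [k _ Hk] := near_infty_natSinv_lt (PosNum e0).
  by exists k; exact: (Hk k (leqnn k)).
move=> ke; have /existsNP[n /not_implyP[_ nx]] : ~ B k t.
  by move=> Bk; apply: nB; exists k.
exists n => // j nj /=; rewrite sub0r normrN ger0_norm//; apply: lt_trans ke.
rewrite ltNge; apply/negP => h; apply: nx; exists j => //.
Qed.

End AlmostSupermartingale.

(** * The dithered quantizer *)

Section Quantizer.
Context {R : realType}.
Variable D : R.
Hypothesis D_gt0 : 0 < D.

Lemma quant_bounds (y : R) : quant D y - D / 2 <= y < quant D y + D / 2.
Proof.
rewrite /quant; set k := Num.floor _.
have := floor_le_tmp (y / D + 2^-1); have := floorD1_gt (y / D + 2^-1).
rewrite -/k intrD => h1 h2.
have yD : y = y / D * D by rewrite divfK// gt_eqF.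
rewrite yD; set u := y / D in h1 h2 *; set kr : R := k%:~R in h1 h2 *.
have : 0 <= (u + 2^-1 - kr) * D by rewrite mulr_ge0 ?subr_ge0 ?(ltW D_gt0).
have : 0 < (kr + 1 - (u + 2^-1)) * D by rewrite mulr_gt0 ?subr_gt0.
lra.
Qed.

Lemma quant_error (x v : R) : - (D / 2) <= v < D / 2 ->
  `|quant D (x + v) - x| <= D.
Proof. by have := quant_bounds (x + v); rewrite ler_norml; lra. Qed.

(** The dither value at which [x + v] crosses the midpoint between the level below [x] and the next
    one. *)
Definition dither_threshold (x : R) : R := ((Num.floor (x / D))%:~R + 2^-1) * D - x.

(** With [k] the floor of [x / D], the sum [x + v] lies in [[(k - 1/2) D, (k + 3/2) D)], so the
    output is [k D] or [(k + 1) D]. *)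
Lemma quant_dither (x v : R) : - (D / 2) <= v < D / 2 ->
  quant D (x + v) =
  (Num.floor (x / D))%:~R * D + D * (dither_threshold x <= v)%R%:R.
Proof.
move=> vD; rewrite /dither_threshold /quant; set k := Num.floor (x / D).
have := floor_le_tmp (x / D); have := floorD1_gt (x / D).
rewrite -/k intrD => h1 h2.
have -> : (x + v) / D + 2^-1 = x / D + v / D + 2^-1 by rewrite mulrDl.
have [w1 w2] : - 2^-1 <= v / D /\ v / D < 2^-1.
  by rewrite ler_pdivlMr// ltr_pdivrMr//; lra.
have -> : ((k%:~R + 2^-1) * D - x <= v) = (k%:~R + 2^-1 - x / D <= v / D).
  by rewrite -[RHS](ler_pM2r D_gt0) mulrBl !divfK// gt_eqF.
set u := x / D in h1 h2 *; set w := v / D in w1 w2 *.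
set kr : R := k%:~R in h1 h2 *.
have [h|h] := leP (kr + 2^-1 - u) w.
  have -> : Num.floor (u + w + 2^-1) = k + 1.
    by apply: floor_def; rewrite !intrD -/kr; lra.
  by rewrite intrD -/kr /=; ring.
have -> : Num.floor (u + w + 2^-1) = k.
  by apply: floor_def; rewrite !intrD -/kr; lra.
by rewrite mulr0 addr0.
Qed.

Lemma dither_threshold_bounds x : - (D / 2) <= dither_threshold x <= D / 2.
Proof.
rewrite /dither_threshold; set k := Num.floor (x / D).
have := floor_le_tmp (x / D); have := floorD1_gt (x / D).
rewrite -/k intrD => h1 h2.
have xD : x = x / D * D by rewrite divfK// gt_eqF.
rewrite xD; set u := x / D in h1 h2 *.
set kr : R := k%:~R in h1 h2 *.
have : 0 <= (u - kr) * D by rewrite mulr_ge0 ?subr_ge0 ?(ltW D_gt0).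
have : 0 < (kr + 1 - u) * D by rewrite mulr_gt0 ?subr_gt0.
lra.
Qed.

Lemma measurable_quant : measurable_fun setT (quant D).
Proof.
apply: measurable_funM => //; apply: nondecreasing_measurable => // x y xy.
by rewrite ler_int; apply: le_floor; rewrite lerD2r ler_pM2r ?invr_gt0.
Qed.

Lemma measurable_floorD :
  measurable_fun setT (fun x : R => (Num.floor (x / D))%:~R : R).
Proof.
apply: nondecreasing_measurable => // x y xy.
by rewrite ler_int; apply: le_floor; rewrite ler_pM2r ?invr_gt0.
Qed.

Lemma measurable_dither_threshold : measurable_fun setT dither_threshold.
Proof.
apply: measurable_funB => //; apply: measurable_funM => //.
by apply: measurable_funD => //; exact: measurable_floorD.
Qed.

(** Given [X], rounding up has probability [(D/2 - threshold) / D = (x - k D) / D]; it adds [D], so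
    on average it restores the gap [x - k D]. In the application [X] is the identity onto [T] with a
    smaller sigma-algebra. *)
Lemma dither_unbiased (d d' : measure_display) (T : measurableType d)
    (S : measurableType d') (P : probability T R)
    (X : T -> S) (Y : T -> R) (h x : S -> R) :
  measurable_fun setT X -> measurable_fun setT Y ->
  (forall t, - (D / 2) <= Y t < D / 2) ->
  (forall B, measurable B -> P (Y @^-1` B) =
     (lebesgue_measure (B `&` `[(- (D / 2))%R, (D / 2)%R[) * (D^-1)%:E)%E) ->
  (forall A B, measurable A -> measurable B ->
    P (X @^-1` A `&` Y @^-1` B) = (P (X @^-1` A) * P (Y @^-1` B))%E) ->
  bounded_mfun h -> bounded_mfun x ->
  \int[P]_t (h (X t) * (quant D (x (X t) + Y t) - x (X t))) = 0.
Proof.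
move=> mX mY YD uY indXY bh bx.
have [mx [Mx hMx]] := bx.
have mth : measurable_fun setT (dither_threshold \o x).
  by apply: measurableT_comp => //; exact: measurable_dither_threshold.
have bX (f : S -> R) : bounded_mfun f -> bounded_mfun (f \o X).
  move=> [mf [M hM]]; split; first exact: measurableT_comp.
  by exists M => t; exact: hM.
pose r s := (Num.floor (x s / D))%:~R * D - x s.
have br : bounded_mfun r.
  split.
    apply: measurable_funB => //; apply: measurable_funM => //.
    exact: (measurableT_comp measurable_floorD).
  exists D => s; rewrite ler_norml.
  have := dither_threshold_bounds (x s); rewrite /dither_threshold /r; lra.
have PY a : - (D / 2) <= a <= D / 2 ->
    fine (P [set u | a <= Y u]) = (D / 2 - a) / D.
  move=> aD; have := uY `[a, +oo[%classic (measurable_itv _).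
  rewrite (_ : Y @^-1` _ = [set u | a <= Y u]); last first.
    by apply/seteqP; split => u /=; rewrite in_itv /= andbT.
  move=> ->; rewrite (_ : _ `&` _ = `[a, (D / 2)[%classic); last first.
    apply/seteqP; split => u /=; rewrite !in_itv /=; lra.
  rewrite lebesgue_measure_itv /= lte_fin.
  (* The value [a = D / 2] arises when [x] is itself a level; the interval is then empty. *)
  have [lt_a|le_a] := ltP a (D / 2); first by rewrite -EFinB -EFinM.
  have -> : a = D / 2 by lra.
  by rewrite subrr !mul0r mul0e.
transitivity (\int[P]_t (h (X t) * r (X t) +
    D * (h (X t) * (dither_threshold (x (X t)) <= Y t)%R%:R))).
  by apply: eq_Rintegral => t _; rewrite quant_dither// /r; ring.
have mge : bounded_mfun (fun t => (dither_threshold (x (X t)) <= Y t)%R%:R : R).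
  rewrite (_ : (fun _ => _) = \1_[set t | dither_threshold (x (X t)) <= Y t]).
    apply: bounded_mfun_indic; rewrite -[X in measurable X]setTI.
    by apply: measurable_fun_ler => //; exact: (measurableT_comp mth mX).
  by apply/funext => t; rewrite indicE mem_setE.
have bhX := bX _ bh; have brX := bX _ br.
have bhr : bounded_mfun (fun t => h (X t) * r (X t)) by exact: bounded_mfunM.
have bhg : bounded_mfun
    (fun t => h (X t) * (dither_threshold (x (X t)) <= Y t)%R%:R).
  exact: bounded_mfunM.
rewrite bounded_RintegralD//; last first.
  by apply: bounded_mfunM => //; exact: bounded_mfun_cst.
rewrite bounded_RintegralZ//.
rewrite (indep_threshold (th := dither_threshold \o x) mX mY indXY bh mth).
have -> : \int[P]_t (h (X t) *
      fine (P [set u | (dither_threshold \o x) (X t) <= Y u])) =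
    \int[P]_t (- D^-1 * (h (X t) * r (X t))).
  apply: eq_Rintegral => t _; rewrite /= PY ?dither_threshold_bounds//.
  rewrite /dither_threshold /r; field; rewrite ?gt_eqF//.
by rewrite bounded_RintegralZ// mulrA mulrN divff ?gt_eqF// mulN1r subrr.
Qed.

End Quantizer.

(** * One step of the recursion *)

Section Step.
Context {R : realType} {N : nat}.

Lemma degreeE (g : @graph N) n : degree g n = \sum_l (g n l)%:R :> R.
Proof.
rewrite /degree -sum1_card natr_sum big_mkcond /=.
by apply: eq_bigr => l _; rewrite unfold_in /in_set /= asboolb; case: (g n l).
Qed.

(** Cauchy-Schwarz against the constant 1, from the Lagrange identity. *)
Lemma sqr_sum_le (u : 'I_N -> R) : (\sum_l u l) ^+ 2 <= N%:R * \sum_l u l ^+ 2.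
Proof.
have : 0 <= \sum_l \sum_k (u l - u k) ^+ 2.
  by apply: sumr_ge0 => l _; apply: sumr_ge0 => k _; exact: sqr_ge0.
have -> : \sum_l \sum_k (u l - u k) ^+ 2 =
    2 * (N%:R * \sum_l u l ^+ 2 - (\sum_l u l) ^+ 2).
  set s2 := \sum_l u l ^+ 2; set s := \sum_l u l.
  have E l : \sum_k (u l - u k) ^+ 2 = N%:R * u l ^+ 2 + s2 - 2 * u l * s.
    rewrite (eq_bigr (fun k => u l ^+ 2 + u k ^+ 2 + (- (2 * u l)) * u k)).
      rewrite big_split big_split /= sumr_const card_ord -[X in _ + X]mulr_sumr.
      by rewrite -/s2 -/s -[u l ^+ 2 *+ N]mulr_natl mulNr.
    by move=> k _; ring.
  under eq_bigr do rewrite E.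
  rewrite sumrB big_split /= sumr_const card_ord -mulr_sumr -/s2 -mulr_suml.
  by rewrite -mulr_sumr -/s -[s2 *+ N]mulr_natl; ring.
lra.
Qed.

(** The new state is compared with the old mean. Terms linear in [a] stay exact, to be averaged
    later. The quadratic term is at most [2 a^2] times the squared Laplacian part (at most [4 N^2]
    times the disagreement) plus the squared error part (at most [N^3 D^2]), both by
    Cauchy-Schwarz. *)
Lemma disagreement_step (x : 'I_N -> R) (g : @graph N) (z : 'I_N -> 'I_N -> R)
    (a D : R) :
  (0 < N)%N -> 0 <= a -> (forall n l, `|z n l| <= D) ->
  disagreement (fun n => (1 - a * degree g n) * x n
                         + a * \sum_(l | g n l) (x l + z n l)) <=
  (1 + 8 * N%:R ^+ 2 * a ^+ 2) * disagreement x + 2 * N%:R ^+ 3 * D ^+ 2 * a ^+ 2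
  - 2 * a * \sum_n \sum_l (g n l)%:R * ((x n - mean x) * (x n - x l))
  + 2 * a * \sum_n \sum_l (x n - mean x) * (g n l)%:R * z n l.
Proof.
move=> N0 a0 zD.
apply: (le_trans (disagreement_le _ (mean x) N0)).
set y := fun n => x n - mean x.
pose b n := \sum_l (g n l)%:R * (y n - y l).
pose e n := \sum_l (g n l)%:R * z n l.
have stepE n : (1 - a * degree g n) * x n + a * \sum_(l | g n l) (x l + z n l)
    - mean x = y n - a * b n + a * e n.
  rewrite big_mkcond /= (eq_bigr (fun l => (g n l)%:R * x l + (g n l)%:R * z n l)).
    rewrite big_split /= -/(e n) /b.
    rewrite [in RHS](eq_bigr (fun l => (g n l)%:R * x n - (g n l)%:R * x l)).
      by rewrite sumrB -mulr_suml -degreeE /y; ring.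
    by move=> l _; rewrite /y; ring.
  by move=> l _; case: (g n l); rewrite ?mul1r// !mul0r addr0.
under eq_bigr do rewrite stepE.
have le1 n : (y n - a * b n + a * e n) ^+ 2 <=
    y n ^+ 2 - 2 * a * (y n * b n) + 2 * a * (y n * e n)
    + 2 * a ^+ 2 * (b n ^+ 2 + e n ^+ 2).
  by have := sqr_ge0 (a * (b n + e n)); nra.
apply: (le_trans (ler_sum _ (fun n _ => le1 n))).
rewrite big_split big_split sumrB /= -!mulr_sumr big_split /=.
have -> : \sum_n \sum_l (g n l)%:R * ((x n - mean x) * (x n - x l)) =
    \sum_n y n * b n.
  apply: eq_bigr => n _; rewrite mulr_sumr; apply: eq_bigr => l _.
  by rewrite /y; ring.
have -> : \sum_n \sum_l (x n - mean x) * (g n l)%:R * z n l =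
    \sum_n y n * e n.
  by apply: eq_bigr => n _; rewrite mulr_sumr; apply: eq_bigr => l _; rewrite mulrA.
have -> : disagreement x = \sum_n y n ^+ 2 by [].
set s2 := \sum_n y n ^+ 2.
have hb : \sum_n b n ^+ 2 <= 4 * N%:R ^+ 2 * s2.
  have hbn n : b n ^+ 2 <= N%:R * (2 * (N%:R * y n ^+ 2 + s2)).
    apply: (le_trans (sqr_sum_le _)); rewrite ler_wpM2l//.
    apply: (@le_trans _ _ (\sum_l 2 * (y n ^+ 2 + y l ^+ 2))).
      apply: ler_sum => l _; case: (g n l); rewrite ?mul1r ?mul0r.
        by have := sqr_ge0 (y n + y l); nra.
      by rewrite expr0n mulr_ge0// addr_ge0// sqr_ge0.
    by rewrite -mulr_sumr big_split /= sumr_const card_ord -[_ *+ N]mulr_natl.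
  apply: (le_trans (ler_sum _ (fun n _ => hbn n))).
  rewrite -mulr_sumr -mulr_sumr big_split /= sumr_const card_ord -mulr_sumr -/s2.
  by rewrite -[s2 *+ N]mulr_natl le_eqVlt; apply/orP; left; apply/eqP; ring.
have he : \sum_n e n ^+ 2 <= N%:R ^+ 3 * D ^+ 2.
  have hen n : e n ^+ 2 <= N%:R * (N%:R * D ^+ 2).
    apply: (le_trans (sqr_sum_le _)); rewrite ler_wpM2l//.
    apply: (@le_trans _ _ (\sum_(l < N) D ^+ 2)).
      apply: ler_sum => l _; rewrite -[leLHS]ger0_norm ?sqr_ge0// normrX.
      rewrite lerXn2r ?nnegrE//; first exact: le_trans (zD n l).
      by case: (g n l); rewrite ?mul1r ?mul0r ?normr0//; exact: le_trans (zD n l).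
    by rewrite sumr_const card_ord -[_ *+ N]mulr_natl.
  apply: (le_trans (ler_sum _ (fun n _ => hen n))).
  rewrite sumr_const card_ord -[_ *+ N]mulr_natl.
  by rewrite le_eqVlt; apply/orP; left; apply/eqP; ring.
have := sqr_ge0 a; set a2 := a ^+ 2 => a20.
have := ler_wpM2l a20 hb; have := ler_wpM2l a20 he.
lra.
Qed.

End Step.

(** * The quantized consensus recursion *)

Lemma sigma_sub_measurable (d : measure_display) (T : measurableType d)
    (G : set (set T)) : G `<=` measurable -> <<s G >> `<=` measurable.
Proof. by move=> Gm; apply: smallest_sub Gm; exact: sigma_algebra_measurable. Qed.

(* Measurability with respect to a sub-sigma-algebra is expressed by retyping [T]
   as [g_sigma_algebraType G]. *)
Lemma bounded_mfun_sigma (d : measure_display) (T : measurableType d)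
    (R : realType) (G : set (set T)) (f : T -> R) : G `<=` measurable ->
  bounded_mfun (f : g_sigma_algebraType G -> R) -> bounded_mfun f.
Proof.
move=> Gm [mf bf]; split=> // _ B mB; apply: (sigma_sub_measurable Gm).
exact: mf.
Qed.

Lemma bounded_mfun_disagreement (d : measure_display) (T : measurableType d)
    (R : realType) (N : nat) (x : 'I_N -> T -> R) :
  (forall n, bounded_mfun (x n)) ->
  bounded_mfun (fun t => disagreement (fun n => x n t)).
Proof.
move=> bx; apply: bounded_mfun_sum => n.
have bxm : bounded_mfun (fun t => x n t - mean (fun n => x n t)).
  apply: bounded_mfunB => //; apply: bounded_mfunM; last exact: bounded_mfun_cst.
  exact: bounded_mfun_sum.
rewrite (_ : (fun t => _) = (fun t => (x n t - mean (fun n => x n t)) *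
  (x n t - mean (fun n => x n t)))); first exact: bounded_mfunM.
by apply/funext => t; rewrite expr2.
Qed.

Lemma bounded_mfun_bool (d : measure_display) (T : measurableType d)
    (R : realType) (b : T -> bool) :
  measurable [set t | b t] -> bounded_mfun (fun t => (b t)%:R : R).
Proof.
move=> mb; rewrite (_ : (fun t => _) = \1_[set t | b t]).
  exact: bounded_mfun_indic.
by apply/funext => t; rewrite indicE mem_setE.
Qed.

(** Measurability is asked of times before [i] only, so that the lemma also applies when [T] carries
    the sigma-algebra of the past. The bound may depend on [i]. *)
Lemma bounded_mfun_qc_state (d : measure_display) (T : measurableType d)
    (R : realType) (N : nat) (A : nat -> T -> @graph N)
    (nu : nat -> 'I_N -> 'I_N -> T -> R) (alpha : nat -> R) (D : R)
    (x0 : 'I_N -> R) (i : nat) :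
  0 < D ->
  (forall j n l, (j < i)%N -> measurable [set t | A j t n l]) ->
  (forall j n l, (j < i)%N -> measurable_fun setT (nu j n l)) ->
  (forall j n l t, - (D / 2) <= nu j n l t < D / 2) ->
  forall n, bounded_mfun (fun t => qc_state x0 alpha D A nu i t n).
Proof.
move=> D0; elim: i => [|i IH] mA mnu nuD n; first exact: bounded_mfun_cst.
have {}IH n' : bounded_mfun (fun t => qc_state x0 alpha D A nu i t n').
  by apply: IH => // j m l ji; [apply: mA|apply: mnu]; exact: leqW.
have bA m l : bounded_mfun (fun t => (A i t m l)%:R : R).
  by apply: bounded_mfun_bool; exact: mA.
rewrite (_ : (fun t => _) = (fun t =>
  (1 - alpha i * \sum_l (A i t n l)%:R) * qc_state x0 alpha D A nu i t n +
  alpha i * \sum_l (A i t n l)%:R *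
    quant D (qc_state x0 alpha D A nu i t l + nu i n l t))); last first.
  apply/funext => t /=; rewrite degreeE; congr (_ + _ * _).
  rewrite big_mkcond; apply: eq_bigr => l _.
  by case: (A i t n l); rewrite ?mul1r ?mul0r.
apply: bounded_mfunD; apply: bounded_mfunM => //.
- apply: bounded_mfunB; first exact: bounded_mfun_cst.
  by apply: bounded_mfunM; [exact: bounded_mfun_cst|exact: bounded_mfun_sum].
- exact: bounded_mfun_cst.
- apply: bounded_mfun_sum => l; apply: bounded_mfunM => //.
  have [mx [M hM]] := IH l; split.
    apply: (measurableT_comp (measurable_quant D0)).
    by apply: measurable_funD => //; exact: mnu.
  exists (D + M) => t; have := quant_error D0 (qc_state x0 alpha D A nu i t l) (nuD i n l t).
  set q := quant _ _; set x := qc_state _ _ _ _ _ _ _ _ => qx.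
  by rewrite -[q](subrK x); apply: (le_trans (ler_normD _ _)); exact: lerD qx (hM t).
Qed.

(** * Consensus for a dither bounded everywhere *)

Section BoundedDither.
Context (R : realType) (N : nat) (d : measure_display) (T : measurableType d).
Variables (P : probability T R) (A : nat -> T -> @graph N).
Variables (nu : nat -> 'I_N -> 'I_N -> T -> R).
Variables (alpha : nat -> R) (D : R) (x0 : 'I_N -> R).
Hypothesis N_ge2 : (2 <= N)%N.
Hypothesis A_simple : forall i t, simple_graph (A i t).
Hypothesis A_measurable : forall i (S : set (@graph N)), measurable (A i @^-1` S).
Hypothesis A_identical :
  forall i (S : set (@graph N)), P (A i @^-1` S) = P (A 0%N @^-1` S).
Hypothesis D_gt0 : 0 < D.
Hypothesis nu_measurable : forall i n l, measurable_fun setT (nu i n l).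
Hypothesis nu_bounded : forall i n l t, - (D / 2) <= nu i n l t < D / 2.
Hypothesis nu_uniform : forall i n l (B : set R), measurable B ->
  P (nu i n l @^-1` B) =
  (lebesgue_measure (B `&` `[(- (D / 2))%R, (D / 2)%R[) * (D^-1)%:E)%E.

Definition qc_event (k : nat + (nat * 'I_N * 'I_N)) : set (set T) :=
  match k with
  | inl i => [set A i @^-1` S | S in [set: set (@graph N)]]
  | inr (i, n, l) => [set nu i n l @^-1` B | B in measurable]
  end.

Hypothesis independent : mutually_independent P qc_event.
Hypothesis lambda2_gt0 : exists lam : seq R,
  sorted_eigenvalues
    (\matrix_(n, l) fine ('E_P[fun t => laplacian (A 0%N t) n l])) lam
  /\ 0 < nth 0 lam 1.
Hypothesis alpha_gt0 : forall i, 0 < alpha i.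
Hypothesis alpha_oo : series alpha @ \oo --> +oo.
Hypothesis alpha_sq : cvgn (series (fun i => alpha i ^+ 2)).

Let x i n t := qc_state x0 alpha D A nu i t n.
Let V i t := disagreement (qc_state x0 alpha D A nu i t).
Let w n l : R := fine (P [set t | A 0%N t n l]).

Definition past_index i : set (nat + (nat * 'I_N * 'I_N)) :=
  [set k | match k with inl j => (j < i)%N | inr (j, _, _) => (j < i)%N end].

Definition past i : set (set T) := \bigcup_(k in past_index i) qc_event k.
(** The errors of time [i] carry adjacency entries of time [i] as coefficients, so their
    conditioning must include that graph. *)
Definition past_graph i : set (set T) :=
  \bigcup_(k in past_index i `|` [set inl i]) qc_event k.

Let qc_event_measurable k : qc_event k `<=` measurable.
Proof.
case: k => [i|[[i n] l]] _ [B mB <-]; first exact: A_measurable.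
by rewrite -[X in measurable X]setTI; exact: nu_measurable.
Qed.

Let qc_eventI k : setI_closed (qc_event k).
Proof.
case: k => [i|[[i n] l]] _ _ [B mB <-] [B' mB' <-]; exists (B `&` B') => //.
exact: measurableI.
Qed.

Let qc_eventT k : qc_event k setT.
Proof. by case: k => [i|[[i n] l]]; exists setT => //; exact: measurableT. Qed.

Let past_measurable i : past i `<=` measurable.
Proof. by move=> B [k _]; exact: qc_event_measurable. Qed.

Let past_graph_measurable i : past_graph i `<=` measurable.
Proof. by move=> B [k _]; exact: qc_event_measurable. Qed.

Let bounded_mfun_x (G : set (set T)) i :
  (forall k, past_index i k -> qc_event k `<=` G) ->
  forall n, bounded_mfun (x i n : g_sigma_algebraType G -> R).
Proof.
move=> GE; apply: (@bounded_mfun_qc_state _ (g_sigma_algebraType G)) => //.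
  move=> j n l ji; apply: sub_sigma_algebra; apply: (GE (inl j) ji).
  by exists [set g | g n l].
move=> j n l ji _ B mB; rewrite setTI; apply: sub_sigma_algebra.
by apply: (GE (inr (j, n, l)) ji); exists B.
Qed.

Let x_past i : forall n, bounded_mfun (x i n : g_sigma_algebraType (past i) -> R).
Proof. by apply: bounded_mfun_x => k ki B kB; exists k. Qed.

Let x_past_graph i :
  forall n, bounded_mfun (x i n : g_sigma_algebraType (past_graph i) -> R).
Proof. by apply: bounded_mfun_x => k ki B kB; exists k => //; left. Qed.

Let bx i n : bounded_mfun (x i n).
Proof. exact: (@bounded_mfun_sigma _ _ _ (past i) (x i n) (@past_measurable i) (@x_past i n)). Qed.

Let bV i : bounded_mfun (V i).
Proof. exact: (@bounded_mfun_disagreement _ _ _ _ (x i) (@bx i)). Qed.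

Let bA i n l : bounded_mfun (fun t => (A i t n l)%:R : R).
Proof. by apply: bounded_mfun_bool; exact: (A_measurable i [set g | g n l]). Qed.

Let A_mean i n l : fine (P [set t | A i t n l]) = w n l.
Proof. by rewrite /w; congr fine; exact: (A_identical i [set g | g n l]). Qed.

Let w_sym n l : w n l = w l n.
Proof.
by rewrite /w; congr (fine (P _)); apply/funext => t /=; rewrite (A_simple 0%N t).1.
Qed.

Let w_ge0 n l : 0 <= w n l. Proof. exact: fine_ge0. Qed.

Let expected_laplacian n l :
  fine ('E_P[fun t => laplacian (A 0%N t) n l]) =
  (n == l)%:R * (\sum_k w n k) - w n l.
Proof.
rewrite unlock -/(Rintegral P setT (fun t => laplacian (A 0%N t) n l)).
have intA m k : \int[P]_t (A 0%N t m k)%:R = w m k.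
  rewrite /w -Rintegral_indic; last exact: (A_measurable 0 [set g | g m k]).
  by apply: eq_Rintegral => t _; rewrite indicE mem_setE.
transitivity (\int[P]_t ((n == l)%:R * (\sum_k (A 0%N t n k)%:R) - (A 0%N t n l)%:R)).
  by apply: eq_Rintegral => t _; rewrite mxE degreeE.
have bS : bounded_mfun (fun t => \sum_k (A 0%N t n k)%:R : R).
  exact: bounded_mfun_sum.
rewrite bounded_RintegralB//; last first.
  by apply: bounded_mfunM => //; exact: bounded_mfun_cst.
rewrite bounded_RintegralZ// bounded_Rintegral_sum// intA.
by congr (_ * _ - _); apply: eq_bigr => k _; rewrite intA.
Qed.

(** The form depends on differences only, so its left factor [y n] may be centred at the mean, as in
    the expansion of one step. *)
Let coercive : exists2 c : R, 0 < c & forall y : 'I_N -> R,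
  c * disagreement y <= \sum_n \sum_l w n l * ((y n - mean y) * (y n - y l)).
Proof.
have [lam [slam lam1]] := lambda2_gt0.
have [|c c0 cP] := weighted_laplacian_coercive N_ge2 w_sym w_ge0 _ lam1.
  move: slam; congr sorted_eigenvalues; apply/matrixP => n l.
  by rewrite !mxE expected_laplacian.
exists c => // y; apply: (le_trans (cP y)); rewrite laplacian_form//.
rewrite [leRHS](eq_bigr (fun n => \sum_l w n l * ((y n - mean y) *
  ((y n - mean y) - (y l - mean y))))); last first.
  by move=> n _; apply: eq_bigr => l _; congr (_ * (_ * _)); ring.
rewrite (laplacian_form (fun n => y n - mean y))// ler_wpM2l//.
apply: ler_sum => n _; apply: ler_sum => l _.
by rewrite le_eqVlt; apply/orP; left; apply/eqP; ring.
Qed.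

(** An edge is present when its indicator is at least 1, so this is the threshold lemma with the
    constant threshold 1 and the identity as [X]. *)
Let graph_average i n l (h : T -> R) :
  bounded_mfun (h : g_sigma_algebraType (past i) -> R) ->
  \int[P]_t (h t * (A i t n l)%:R) = w n l * \int[P]_t h t.
Proof.
move=> bh.
have mid : measurable_fun setT (id : T -> g_sigma_algebraType (past i)).
  by move=> _ B mB; rewrite setTI; exact: (sigma_sub_measurable (@past_measurable i)).
have [mA _] := bA i n l.
have ind B C : @measurable _ (g_sigma_algebraType (past i)) B -> measurable C ->
    P (id @^-1` B `&` (fun t => (A i t n l)%:R : R) @^-1` C) =
    (P (id @^-1` B) * P ((fun t => (A i t n l)%:R : R) @^-1` C))%E.
  move=> mB mC.
  apply: (mutually_independent_sigma qc_event_measurable qc_eventI qc_eventT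
    independent (J := past_index i) (k := inl i)) => //; first by rewrite /= ltnn.
  by exists [set g | C (g n l)%:R].
have m1 : measurable_fun setT (fun _ : g_sigma_algebraType (past i) => 1 : R).
  exact: measurable_cst.
have := indep_threshold mid mA ind bh m1.
rewrite /= => E; transitivity (\int[P]_t (h t * (1 <= (A i t n l)%:R :> R)%R%:R)).
  apply: eq_Rintegral => t _; case: (A i t n l); rewrite ?lexx//.
  by rewrite ler10.
rewrite E -bounded_RintegralZ; last exact: (bounded_mfun_sigma (@past_measurable i)).
apply: eq_Rintegral => t _; rewrite mulrC; congr (_ * _).
rewrite -(A_mean i); congr (fine (P _)); apply/seteqP; split => u /=;
  case: (A i u n l) => //; by rewrite ler10.
Qed.

(** The weight [h] may involve the graph of time [i] but no dither of time [i]: the index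
    [inr (i, n, l)] lies outside the generating family. *)
Let dither_average i n l (h : T -> R) :
  bounded_mfun (h : g_sigma_algebraType (past_graph i) -> R) ->
  \int[P]_t (h t * (quant D (x i l t + nu i n l t) - x i l t)) = 0.
Proof.
move=> bh.
have mid : measurable_fun setT (id : T -> g_sigma_algebraType (past_graph i)).
  by move=> _ B mB; rewrite setTI; exact: (sigma_sub_measurable (@past_graph_measurable i)).
have ind B C : @measurable _ (g_sigma_algebraType (past_graph i)) B -> measurable C ->
    P (id @^-1` B `&` nu i n l @^-1` C) = (P (id @^-1` B) * P (nu i n l @^-1` C))%E.
  move=> mB mC.
  apply: (mutually_independent_sigma qc_event_measurable qc_eventI qc_eventT
    independent (J := past_index i `|` [set inl i]) (k := inr (i, n, l))) => //.
    by rewrite /= ltnn; case.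
  by exists C.
exact: (@dither_unbiased _ _ D_gt0 _ _ _ (g_sigma_algebraType (past_graph i)) P
  id (nu i n l) h (x i l) mid (nu_measurable i n l) (nu_bounded i n l)
  (@nu_uniform i n l) ind bh (@x_past_graph i l)).
Qed.

(** After multiplication by the indicator of [H], averaging the graph replaces adjacency entries by
    [w], where coercivity applies, and averaging the dither removes the error term. *)
Let drift c i H :
  (forall y : 'I_N -> R,
  c * disagreement y <= \sum_n \sum_l w n l * ((y n - mean y) * (y n - y l))) ->
  <<s past i >> H ->
  \int[P]_t (\1_H t * V i.+1 t) <=
  (1 + 8 * N%:R ^+ 2 * alpha i ^+ 2 - 2 * alpha i * c) * \int[P]_t (\1_H t * V i t)
  + 2 * N%:R ^+ 3 * D ^+ 2 * alpha i ^+ 2.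
Proof.
move=> cP sH; have a0 := ltW (alpha_gt0 i).
have mH : measurable H by exact: (sigma_sub_measurable (@past_measurable i)).
have bH := bounded_mfun_indic R mH.
have bHp : bounded_mfun (\1_H : g_sigma_algebraType (past i) -> R).
  exact: bounded_mfun_indic.
have sub : past i `<=` past_graph i by move=> B [k ki kB]; exists k => //; left.
have bHg : bounded_mfun (\1_H : g_sigma_algebraType (past_graph i) -> R).
  by apply: bounded_mfun_indic; exact: (@sub_sigma_algebra2 _ setT _ _ sub).
pose y n t := x i n t - mean (fun n => x i n t).
have dev_bounded (d' : measure_display) (S : measurableType d') (xs : 'I_N -> S -> R) n :
    (forall n, bounded_mfun (xs n)) ->
    bounded_mfun (fun t => xs n t - mean (fun n => xs n t)).
  move=> bxs; apply: bounded_mfunB => //.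
  by apply: bounded_mfunM; [exact: bounded_mfun_sum|exact: bounded_mfun_cst].
pose F n l t := \1_H t * (y n t * (x i n t - x i l t)).
have bFp n l : bounded_mfun (F n l : g_sigma_algebraType (past i) -> R).
  apply: bounded_mfunM => //; apply: bounded_mfunM; first exact: dev_bounded.
  by apply: bounded_mfunB; exact: x_past.
have bF n l : bounded_mfun (F n l).
  exact: (bounded_mfun_sigma (@past_measurable i) (bFp n l)).
(* The coefficient of the error [z]: it depends on the past and the current graph, whereas [F]
   depends on the past alone. *)
pose K n l t := \1_H t * y n t * (A i t n l)%:R.
have bKg n l : bounded_mfun (K n l : g_sigma_algebraType (past_graph i) -> R).
  apply: bounded_mfunM; first by apply: bounded_mfunM => //; exact: dev_bounded.
  apply: (@bounded_mfun_bool _ (g_sigma_algebraType (past_graph i))).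
  apply: sub_sigma_algebra; exists (inl i); first by right.
  by exists [set g | g n l].
have bK n l : bounded_mfun (K n l).
  exact: (bounded_mfun_sigma (@past_graph_measurable i) (bKg n l)).
pose z n l t := quant D (x i l t + nu i n l t) - x i l t.
have zD n l t : `|z n l t| <= D by exact: quant_error.
have bz n l : bounded_mfun (z n l).
  split; last by exists D => t; exact: zD.
  have [mx _] := bx i l; apply: measurable_funB => //.
  apply: (measurableT_comp (measurable_quant D_gt0)).
  exact: measurable_funD.
set k1 := 1 + 8 * N%:R ^+ 2 * alpha i ^+ 2.
set k2 := 2 * N%:R ^+ 3 * D ^+ 2 * alpha i ^+ 2.
set a := alpha i.
have step t : \1_H t * V i.+1 t <=
    k1 * (\1_H t * V i t) + k2 * \1_H t
    - 2 * a * \sum_n \sum_l F n l t * (A i t n l)%:R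
    + 2 * a * \sum_n \sum_l K n l t * z n l t.
  have := @disagreement_step _ _ (fun n => x i n t) (A i t) (fun n l => z n l t)
    a D (ltnW N_ge2) a0 (fun n l => zD n l t).
  have -> : disagreement (fun n => (1 - a * degree (A i t) n) * x i n t +
      a * \sum_(l | A i t n l) (x i l t + z n l t)) = V i.+1 t.
    rewrite /V /=; congr disagreement; apply/funext => n; congr (_ + _ * _).
    by apply: eq_bigr => l _; rewrite /z addrC subrK.
  rewrite -/k1 -/k2 -/(V i t) => st.
  have H0 : 0 <= \1_H t :> R by rewrite indicE.
  apply: (le_trans (ler_wpM2l H0 st)).
  rewrite !mulrDr mulrN; set s1 := \sum_n \sum_l _; set s2 := \sum_n \sum_l _.
  set s3 := \sum_n \sum_l _; set s4 := \sum_n \sum_l _.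
  have -> : s3 = \1_H t * s1.
    rewrite mulr_sumr; apply: eq_bigr => n _; rewrite mulr_sumr.
    by apply: eq_bigr => l _; rewrite /F /y; ring.
  have -> : s4 = \1_H t * s2.
    rewrite mulr_sumr; apply: eq_bigr => n _; rewrite mulr_sumr.
    by apply: eq_bigr => l _; rewrite /K /y; ring.
  by rewrite le_eqVlt; apply/orP; left; apply/eqP; ring.
have b1 : bounded_mfun (fun t => \1_H t * V i t) by exact: bounded_mfunM.
have bFA n l : bounded_mfun (fun t => F n l t * (A i t n l)%:R).
  exact: bounded_mfunM.
have bKz n l : bounded_mfun (fun t => K n l t * z n l t) by exact: bounded_mfunM.
have bs1 : bounded_mfun (fun t => \sum_n \sum_l F n l t * (A i t n l)%:R).
  by apply: bounded_mfun_sum => n; exact: bounded_mfun_sum.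
have bs2 : bounded_mfun (fun t => \sum_n \sum_l K n l t * z n l t).
  by apply: bounded_mfun_sum => n; exact: bounded_mfun_sum.
have bcst (e : R) f : bounded_mfun f -> bounded_mfun (fun t : T => e * f t).
  by apply: bounded_mfunM; exact: bounded_mfun_cst.
have I1 : \int[P]_t (\sum_n \sum_l F n l t * (A i t n l)%:R) =
    \int[P]_t (\sum_n \sum_l w n l * F n l t).
  rewrite !bounded_Rintegral_sum; last 2 first.
  - by move=> n; apply: bounded_mfun_sum => l; exact: bcst.
  - by move=> n; exact: bounded_mfun_sum.
  apply: eq_bigr => n _; rewrite !bounded_Rintegral_sum//; last first.
    by move=> l; exact: bcst.
  by apply: eq_bigr => l _; rewrite graph_average// bounded_RintegralZ.
have I2 : \int[P]_t (\sum_n \sum_l K n l t * z n l t) = 0.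
  rewrite bounded_Rintegral_sum; last by move=> n; exact: bounded_mfun_sum.
  apply: big1 => n _; rewrite bounded_Rintegral_sum//.
  by apply: big1 => l _; exact: dither_average.
have I3 : c * \int[P]_t (\1_H t * V i t) <= \int[P]_t (\sum_n \sum_l w n l * F n l t).
  rewrite -bounded_RintegralZ//; apply: bounded_Rintegral_le.
  - exact: bcst.
  - by apply: bounded_mfun_sum => n; apply: bounded_mfun_sum => l; exact: bcst.
  move=> t; have H0 : 0 <= \1_H t :> R by rewrite indicE.
  have := ler_wpM2l H0 (cP (fun n => x i n t)); rewrite -/(V i t) mulrCA.
  move=> /le_trans; apply; rewrite mulr_sumr; apply: ler_sum => n _.
  rewrite mulr_sumr; apply: ler_sum => l _.
  by rewrite /F /y le_eqVlt; apply/orP; left; apply/eqP; ring.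
have PH : \int[P]_t (\1_H t : R) <= 1.
  rewrite Rintegral_indic// -lee_fin fineK ?fin_num_measure//.
  exact: probability_le1.
have := @bounded_Rintegral_le _ _ _ P _ _ (bounded_mfunM bH (bV i.+1)) _ step.
have bA1 : bounded_mfun (fun t => k1 * (\1_H t * V i t) + k2 * \1_H t).
  by apply: bounded_mfunD; exact: bcst.
have bA2 : bounded_mfun (fun t => k1 * (\1_H t * V i t) + k2 * \1_H t
    - 2 * a * \sum_n \sum_l F n l t * (A i t n l)%:R).
  by apply: bounded_mfunB => //; exact: bcst.
rewrite bounded_RintegralD//; last exact: bcst.
rewrite bounded_RintegralB//; last exact: bcst.
rewrite bounded_RintegralD//; [|exact: bcst|exact: bcst].
rewrite !bounded_RintegralZ// I1 I2 mulr0 addr0.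
have k20 : 0 <= k2.
  exact: (mulr_ge0 (mulr_ge0 (mulr_ge0 (ler0n _ 2) (exprn_ge0 3 (ler0n _ N)))
    (sqr_ge0 _)) (sqr_ge0 _)).
have := ler_wpM2l k20 PH; rewrite mulr1 => h1.
have a20 : 0 <= 2 * a by rewrite mulr_ge0.
have := ler_wpM2l a20 I3 => h2 /(_ (bounded_mfunD bA2 (bcst _ _ bs2))) h3.
apply: (le_trans h3); lra.
Qed.

Theorem bounded_dither_consensus : {ae P, forall t, V ^~ t @ \oo --> 0}.
Proof.
have [c c0 cP] := coercive.
(* Beyond [n0] the quadratic term costs at most [c * alpha], which leaves half of the gain
   [2 * c * alpha]. *)
have [n0 _ Hn0] : \forall n \near \oo, 8 * N%:R ^+ 2 * alpha n <= c.
  pose b : R := 8 * N%:R ^+ 2 + 1.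
  have b0 : 0 < b by rewrite ltr_wpDl// mulr_ge0// sqr_ge0.
  (* Smallness of [alpha] is drawn from the summable squares, hence the squared threshold. *)
  have cb : 0 < (c / b) ^+ 2 by rewrite exprn_gt0// divr_gt0.
  have /cvgrPdist_lt/(_ _ cb) := cvg_series_cvg_0 alpha_sq.
  apply: filterS => n; rewrite sub0r normrN ger0_norm ?sqr_ge0//.
  have an0 := alpha_gt0 n; have cb0 : 0 <= c / b by rewrite ltW ?divr_gt0.
  rewrite ltr_pXn2r ?nnegrE ?(ltW an0)//= ltr_pdivlMr// => h.
  by rewrite /b in h; lra.
apply: (@almost_supermartingale_cvg0 _ _ _ P V past alpha c
  (2 * N%:R ^+ 3 * D ^+ 2) n0) => //.
- by move=> i B [[j|[[j n] l]] ji kB]; [exists (inl j)|exists (inr (j, n, l))] => //;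
    exact: leqW.
- by move=> i t; exact: disagreement_ge0.
- move=> i e; have := @bounded_mfun_disagreement _ (g_sigma_algebraType (past i)) _ _
    (x i) (@x_past i).
  move=> [mV _]; have -> : [set t | V i t < e] = setT `&` V i @^-1` `]-oo, e[%classic.
    by rewrite setTI; apply/seteqP; split => t /=; rewrite in_itv.
  by apply: mV => //; exact: measurable_itv.
- by exact: (mulr_ge0 (mulr_ge0 (ler0n _ 2) (exprn_ge0 3 (ler0n _ N))) (sqr_ge0 _)).
- move=> i H ni sH; apply: (le_trans (drift cP sH)); rewrite lerD2r ler_wpM2r//.
    apply: Rintegral_ge0 => t _; by rewrite mulr_ge0 ?disagreement_ge0.
  have := ler_wpM2r (ltW (alpha_gt0 i)) (Hn0 i ni); rewrite expr2; lra.
Qed.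

End BoundedDither.

(* The dither lies in [-D/2, D/2) only almost surely; clipping makes the
   state bounded everywhere and changes it on a negligible event only. *)
Definition clip {R : realType} (D v : R) : R :=
  if - (D / 2) <= v < D / 2 then v else 0.

Section Clip.
Context {R : realType}.
Variable D : R.
Hypothesis D_gt0 : 0 < D.

Lemma clip_bounds (v : R) : - (D / 2) <= clip D v < D / 2.
Proof. by rewrite /clip; case: ifPn => // _; rewrite oppr_le0 divr_ge0 ?divr_gt0 ?ltW. Qed.

Lemma clip_id (v : R) : - (D / 2) <= v < D / 2 -> clip D v = v.
Proof. by rewrite /clip => ->. Qed.

Lemma measurable_clip : measurable_fun setT (clip D).
Proof.
pose I := `[(- (D / 2))%R, (D / 2)%R[%classic : set R.
rewrite (_ : clip D = fun v => v * \1_I v).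
  apply: measurable_funM => //; apply: measurable_indic; exact: measurable_itv.
apply/funext => v; rewrite /clip indicE mem_setE in_itv /=.
by case: ifP => _; rewrite ?mulr1 ?mulr0.
Qed.

End Clip.

Lemma qc_state_ext (R : realType) (N : nat) (T : Type) (A : nat -> T -> @graph N)
    (nu nu' : nat -> 'I_N -> 'I_N -> T -> R) (alpha : nat -> R) (D : R)
    (x0 : 'I_N -> R) (t : T) :
  (forall i n l, nu i n l t = nu' i n l t) ->
  forall i, qc_state x0 alpha D A nu i t = qc_state x0 alpha D A nu' i t.
Proof.
move=> e; elim=> [//|i IH] /=; rewrite IH; apply/funext => n; congr (_ + _ * _).
by apply: eq_bigr => l _; rewrite e.
Qed.

Lemma negligible_countable (d : measure_display) (T : measurableType d)
    (R : realType) (mu : {measure set T -> \bar R}) (I : countType)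
    (B : I -> set T) :
  (forall i, mu.-negligible (B i)) -> mu.-negligible (\bigcup_i B i).
Proof.
move=> nB; pose F k := if unpickle k is Some i then B i else set0.
apply: (@negligibleS _ _ _ _ (\bigcup_k F k)).
  by move=> t [i _ Bt]; exists (pickle i) => //; rewrite /F pickleK.
apply: negligible_bigcup => k; rewrite /F.
by case: unpickle => [i|]; [exact: nB|exact: negligible_set0].
Qed.
Unset Implicit Arguments.

Theorem mainTheorem1 (R : realType) (N : nat) (d : measure_display)
  (T : measurableType d) (P : probability T R)
  (A : nat -> T -> @graph N) (nu : nat -> 'I_N -> 'I_N -> T -> R)
  (alpha : nat -> R) (Delta : R) (x0 : 'I_N -> R) :
  (2 <= N)%N ->
  (* random simple graphs, measurable *)
  (forall i t, simple_graph (A i t)) ->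
  (forall i (S : set (@graph N)), measurable (A i @^-1` S)) ->
  (* identically distributed *)
  (forall i (S : set (@graph N)), P (A i @^-1` S) = P (A 0%N @^-1` S)) ->
  (* dither: measurable, uniform on [-Delta/2, Delta/2) *)
  0 < Delta ->
  (forall i n l, measurable_fun setT (nu i n l)) ->
  (forall i n l (B : set R), measurable B ->
     P (nu i n l @^-1` B) =
     (lebesgue_measure (B `&` `[(- (Delta / 2))%R, (Delta / 2)%R[) * (Delta^-1)%:E)%E) ->
  (* {L(i)}_i and {nu_nl(i)}_{i,n,l} are jointly mutually independent *)
  mutually_independent P
    (fun k : nat + (nat * 'I_N * 'I_N) => match k with
      | inl i => [set A i @^-1` S | S in [set: set (@graph N)]]
      | inr (i, n, l) => [set nu i n l @^-1` B | B in measurable]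
      end) ->
  (* lambda_2 of the expected Laplacian is positive *)
  (exists lam : seq R,
     sorted_eigenvalues
       (\matrix_(n, l) fine ('E_P[fun t => laplacian (A 0%N t) n l])) lam
     /\ 0 < nth 0 lam 1) ->
  (* step sizes *)
  (forall i, 0 < alpha i) ->
  series alpha @ \oo --> +oo ->
  cvgn (series (fun i => alpha i ^+ 2)) ->
  {ae P, forall t,
     (fun i => dist_consensus (qc_state x0 alpha Delta A nu i t)) @ \oo --> 0}.
Proof.
move=> N2 sA mA idA D0 mnu unu ind lam a0 aoo a2.
pose nu' i n l t := clip Delta (nu i n l t).
have mnu' i n l : measurable_fun setT (nu' i n l).
  exact: (measurableT_comp (measurable_clip Delta)).
(* Clipping is the identity on the interval that carries the law, so the law is unchanged. *)
have unu' i n l (B : set R) : measurable B -> P (nu' i n l @^-1` B) =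
    (lebesgue_measure (B `&` `[(- (Delta / 2))%R, (Delta / 2)%R[) * (Delta^-1)%:E)%E.
  move=> mB; have mcB : measurable (clip Delta @^-1` B).
    by rewrite -[X in measurable X]setTI; exact: measurable_clip.
  rewrite -[X in P X]/(nu i n l @^-1` (clip Delta @^-1` B)) unu//.
  congr (lebesgue_measure _ * _)%E; apply/seteqP; split => v /= [Bv Iv]; split => //;
    by move: Bv; rewrite clip_id//; move: Iv; rewrite in_itv.
(* Events of a clipped dither are events of the original one, by taking preimages under [clip]. *)
have ind' : mutually_independent P (qc_event A nu').
  move=> J F uJ JF; apply: ind => // -[i|[[i n] l]] kJ; have [B mB <-] := JF _ kJ.
    by exists B.
  exists (clip Delta @^-1` B) => //.
  by rewrite -[X in measurable X]setTI; exact: measurable_clip.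
have := bounded_dither_consensus x0 N2 sA mA idA D0 mnu'
  (fun i n l t => clip_bounds D0 (nu i n l t)) unu' ind' lam a0 aoo a2.
(* Only countably many dithers occur, and each leaves the interval with probability 0. *)
have : {ae P, forall t, forall k : nat * 'I_N * 'I_N,
    nu' k.1.1 k.1.2 k.2 t = nu k.1.1 k.1.2 k.2 t}.
  apply: (@negligibleS _ _ _ _ (\bigcup_(k : nat * 'I_N * 'I_N)
    (nu k.1.1 k.1.2 k.2 @^-1` ~` `[(- (Delta / 2))%R, (Delta / 2)%R[))).
    move=> t /= /existsNP[k ne]; exists k => //=; apply: contra_not ne => /=.
    by rewrite in_itv => /= h; exact: clip_id.
  apply: negligible_countable => -[[i n] l] /=.
  have mI : measurable (~` `[(- (Delta / 2))%R, (Delta / 2)%R[%classic : set R).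
    by apply: measurableC; exact: measurable_itv.
  apply/negligibleP.
    by rewrite -[X in measurable X]setTI; exact: mnu.
  by have := unu i n l _ mI; rewrite setICl measure0 mul0e.
apply: filterS2 => t nuE V0.
have sE i := @qc_state_ext _ _ _ A nu' nu alpha Delta x0 t
  (fun i n l => nuE (i, n, l)) i.
have VE : (fun i => disagreement (qc_state x0 alpha Delta A nu' i t)) =
    (fun i => disagreement (qc_state x0 alpha Delta A nu i t)).
  by apply/funext => i; rewrite sE.
have V1 : (fun i => disagreement (qc_state x0 alpha Delta A nu i t)) @ \oo --> 0.
  by rewrite -VE; exact: V0.
have := continuous_cvg _ (@sqrt_continuous R 0) V1.
rewrite sqrtr0 => sV1.
(* The distance is squeezed between 0 and the root of the disagreement. *)
apply: (@squeeze_cvgr _ _ _ _ (fun=> 0)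
  (fun i => Num.sqrt (disagreement (qc_state x0 alpha Delta A nu i t)))).
- by apply: nearW => i; rewrite dist_consensus_ge0 dist_consensus_le.
- exact: cvg_cst.
- exact: sV1.
Qed.
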